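(* Let $E(q)=\prod_{k\ge1}(1-q^k)$, $X=\frac{E(q^2)^4E(q^3)^8}{E(q)^8E(q^6)^4}$, and define $g(n)$ by $\sum_{n\ge0}g(n)q^n=\frac{E(q^2)^5}{E(q)^4}$. Define integer matrices $(a(i,j))_{i,j\ge1}$ and $(b(i,j))_{i,j\ge1}$ as follows. The first three rows are (entries listed for $j=1,2,\dots$; all further entries in these rows are $0$): \begin{itemize} \item $a(1,\cdot)=(10,-36,27)$; $a(2,\cdot)=(-8,306,-2160,5508,-5832,2187)$; $a(3,\cdot)=(1,-360,10566,-99144,423549,-944784,1141614,-708588,177147)$; \item $b(1,\cdot)=(-9,252,-891,729)$; $b(2,\cdot)=(1,-378,8613,-54675,138510,-150903,59049)$; $b(3,\cdot)=(0,147,-14553,312255,-2617839,10764414,-23914845,29288304,-18600435,4782969)$. \end{itemize} For $i\ge4$ and $j\ge1$, both $m=a$ and $m=b$ satisfy $$m(i,j)=30m(i-1,j-1)-108m(i-1,j-2)+81m(i-1,j-3)-12m(i-2,j-1)+9m(i-2,j-2)+m(i-3,j-1),$$ with $m(i,j)=0$ whenever $j\le0$. Define integer sequences $d_\alpha=(d_\alpha(j))_{j\ge1}$ for $\alpha\ge1$ by $d_1=(9,0,0,\dots)$ and, for $\alpha\ge2$, $d_\alpha(j)=\sum_{k\ge1}a(k,j)d_{\alpha-1}(k)$ if $\alpha$ is even and $d_\alpha(j)=\sum_{k\ge1}b(k,j)d_{\alpha-1}(k)$ if $\alpha$ is odd. Then for every $\alpha\ge1$, \begin{align*} \sum_{n\ge0}g\left(3^{2\alpha-1}n+\frac{3^{2\alpha}-1}{4}\right)q^n&=\frac{E(q^6)^5}{E(q^3)^4}\sum_{j\ge1}d_{2\alpha-1}(j)X^j,\\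 \sum_{n\ge0}g\left(3^{2\alpha}n+\frac{3^{2\alpha}-1}{4}\right)q^n&=\frac{E(q^2)^5}{E(q)^4}\sum_{j\ge1}d_{2\alpha}(j)X^j. \end{align*}
   Context: All sums defining $d_\alpha(j)$ are finite (each $d_\alpha$ has finitely many nonzero entries). Identities are of formal power series in $q$. *)

(* Defs.v *)
From HB Require Import structures.
From Stdlib Require Import NArith.
From mathcomp Require Import all_boot all_order all_algebra.
Set Implicit Arguments. Unset Strict Implicit. Unset Printing Implicit Defensive.
Import Order.TTheory GRing.Theory Num.Theory.
Local Open Scope ring_scope.

(* formal power series with integer coefficients: n |-> coefficient of q^n *)
Definition series := nat -> int.

Definition sone : series := fun n => if n == 0%N then 1 else 0.
Definition smul (f g : series) : series :=
  fun n => \sum_(i < n.+1) f i * g (n - i)%N.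
Definition spow (f : series) (k : nat) : series := iter k (smul f) sone.

(* Multiplicative inverse of a series with constant term 1
   (c_0 = 1, c_n = - sum_{i=1..n} f_i c_{n-i}). *)
Fixpoint inv_list (f : series) (n : nat) : seq int :=
  match n with
  | 0%N => [:: 1]
  | n'.+1 => let s := inv_list f n' in
      rcons s (- \sum_(k < n'.+1) f k.+1 * nth 0 s (n' - k)%N)
  end.
Definition sinv (f : series) : series := fun n => nth 0 (inv_list f n) n.

(* E(q^k) = prod_{m>=1} (1 - q^{k m}); for k >= 1 the coefficient of q^n
   only depends on the factors with m <= n. *)
Definition Eq (k : nat) : series :=
  fun n => (\prod_(1 <= m < n.+1) (1 - 'X^(k * m)) : {poly int})`_n.

Definition Xs : series :=
  smul (smul (spow (Eq 2) 4) (spow (Eq 3) 8))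
       (sinv (smul (spow (Eq 1) 8) (spow (Eq 6) 4))).

Definition gser : series := smul (spow (Eq 2) 5) (sinv (spow (Eq 1) 4)).
Definition g (n : nat) : int := gser n.

(* matrices a, b : indices i, j >= 1; entries with i = 0 or j = 0 are 0 *)
Definition row_of (s : seq int) : nat -> int :=
  fun j => if j is j'.+1 then nth 0 s j' else 0.

Definition mstep (x y z : nat -> int) : nat -> int :=
  fun j => if j is 0%N then 0 else
    30 * z (j - 1)%N - 108 * z (j - 2)%N + 81 * z (j - 3)%N
    - 12 * y (j - 1)%N + 9 * y (j - 2)%N + x (j - 1)%N.

(* rows (i+1, i+2, i+3) *)
Fixpoint mtriple (r1 r2 r3 : nat -> int) (i : nat) :
    (nat -> int) * (nat -> int) * (nat -> int) :=
  match i with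
  | 0%N => (r1, r2, r3)
  | i'.+1 => let: (x, y, z) := mtriple r1 r2 r3 i' in (y, z, mstep x y z)
  end.

Definition mat (r1 r2 r3 : seq int) (i j : nat) : int :=
  if i is i'.+1 then (mtriple (row_of r1) (row_of r2) (row_of r3) i').1.1 j
  else 0.

(* integer literals written via binary naturals to avoid unary blow-up *)
Definition pz (n : BinNums.N) : int := Posz (nat_of_bin n).
Definition nz (n : BinNums.N) : int := - Posz (nat_of_bin n).
Arguments pz n%_num.
Arguments nz n%_num.

Definition amat : nat -> nat -> int :=
  mat [:: pz 10%num; nz 36%num; pz 27%num]
      [:: nz 8%num; pz 306%num; nz 2160%num; pz 5508%num; nz 5832%num; pz 2187%num]
      [:: pz 1%num; nz 360%num; pz 10566%num; nz 99144%num; pz 423549%num; nz 944784%num; pz 1141614%num; nz 708588%num; pz 177147%num].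

Definition bmat : nat -> nat -> int :=
  mat [:: nz 9%num; pz 252%num; nz 891%num; pz 729%num]
      [:: pz 1%num; nz 378%num; pz 8613%num; nz 54675%num; pz 138510%num; nz 150903%num; pz 59049%num]
      [:: pz 0%num; pz 147%num; nz 14553%num; pz 312255%num; nz 2617839%num; pz 10764414%num; nz 23914845%num; pz 29288304%num;
          nz 18600435%num; pz 4782969%num].

(* d_alpha(j).  The support of d_alpha is contained in [1, 4^alpha]
   (rows k of a, b vanish beyond columns 3k, 3k+1), so the sum over k >= 1
   may be taken over 1 <= k <= 4^(alpha-1) without changing its value. *)
Fixpoint dseq (al : nat) : nat -> int :=
  match al with
  | 0%N => fun _ => 0
  | 1%N => fun j => if j == 1%N then 9 else 0
  | al'.+1 => let prev := dseq al' in
      fun j => \sum_(1 <= k < (4 ^ al').+1)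
                 (if odd al'.+1 then bmat k j else amat k j) * prev k
  end.

(* sum_{j >= 1} d_alpha(j) X^j  (d_alpha supported in [1, 4^alpha]) *)
Definition dXsum (al : nat) : series :=
  fun n => \sum_(1 <= j < (4 ^ al).+1) dseq al j * spow Xs j n.

(* Main.v *)
(** Put phi = E(q)^2/E(q^2) and psi = E(q^2)^2/E(q), so that X = (phi(q^3)/phi)^4 and
the generating function of g is G = psi^2/phi.  The Jacobi triple product gives the
3-dissections phi = phi(q^9) (1 - u) and 2 psi = A(q^3) (2 + u), where u = 2 q w(q^3)
for one and the same series w.  Taking the norm of phi over the series in q^3 yields
v (1 - u^3) = 1 for v = X(q^3), hence X = v^3 (1 + u + u^2)^4.  Every X^i, and up to a
series in q^3 every G X^i, is therefore a polynomial in u of degree at most 2 with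
coefficients in Z[v]; extracting the exponents congruent to 0 (resp. 2) modulo 3 selects
the coefficient of 1 (resp. u^2), and those coefficients are the rows of a and b.  Their
recurrence is the cubic equation satisfied by X over Z[v]. *)

From HB Require Import structures.
Require Import Defs.
From mathcomp Require Import all_boot all_order all_algebra.
From mathcomp Require Import boolp ring zify.
Set Implicit Arguments.
Unset Strict Implicit.
Unset Printing Implicit Defensive.
Import GRing.Theory Num.Theory.
Local Open Scope ring_scope.

(** * The ring of power series *)

(** All coefficients stay integral, and this shapes the proof. The norm is a polynomial in the three
    sections, so no cube root of unity is adjoined. Each theta identity is an exact identity with
    finite parameter [n]; it turns into a congruence modulo q^n, and series congruent for every [n]
    are equal. Quotients are handled by clearing denominators and cancelling series of constant term
    1 or positive integers. The 2 in 2 psi appears because a bilateral sum over triangular numbers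
    counts each of them twice. Reductions keep a factor v at hand: u^3 = 1 - 1/v is not a polynomial
    in v, but v u^3 = v - 1 is. The prefactors alternate for this reason: G(q^3) passes through the
    section of residue 0 and becomes G, while the section of residue 2 sends u^2 to 4 w^2, and A w =
    psi(q^3) then rebuilds G(q^3) = psi(q^3)^2/phi(q^3). *)

HB.instance Definition _ := gen_eqMixin series.
HB.instance Definition _ := gen_choiceMixin series.

Definition szero : series := fun _ => 0.
Definition sadd (f g : series) : series := fun n => f n + g n.
Definition sopp (f : series) : series := fun n => - f n.

Fact saddA : associative sadd.
Proof. by move=> f g h; apply: funext => n; exact: addrA. Qed.
Fact saddC : commutative sadd.
Proof. by move=> f g; apply: funext => n; exact: addrC. Qed.
Fact sadd0 : left_id szero sadd.
Proof. by move=> f; apply: funext => n; exact: add0r. Qed.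
Fact saddN : left_inverse szero sopp sadd.
Proof. by move=> f; apply: funext => n; exact: addNr. Qed.

HB.instance Definition _ := GRing.isZmodule.Build series saddA saddC sadd0 saddN.

Fact smulC : commutative smul.
Proof.
move=> f g; apply: funext => n; rewrite /smul (reindex_inj rev_ord_inj) /=.
by apply: eq_bigr => i _; rewrite mulrC subSS subKn // -ltnS.
Qed.

Definition trunc (n : nat) (f : series) : {poly int} := \poly_(i < n) f i.

Lemma smul_trunc N (f g : series) n : (n < N)%N ->
  smul f g n = (trunc N f * trunc N g)`_n.
Proof.
move=> nN; rewrite coefM; apply: eq_bigr => i _.
by rewrite !coef_poly (leq_ltn_trans _ nN) ?leq_ord // (leq_ltn_trans _ nN) ?leq_subr.
Qed.

Lemma smul_coef_eq f f' g g' n :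
  (forall i, (i <= n)%N -> f i = f' i) -> (forall i, (i <= n)%N -> g i = g' i) ->
  smul f g n = smul f' g' n.
Proof.
move=> ff' gg'; apply: eq_bigr => i _; rewrite ff' ?gg' ?leq_subr //.
by rewrite -ltnS.
Qed.

(** Coefficient [n] of a product only sees coefficients up to [n] of the factors, so associativity
    is inherited from truncations in [{poly int}]. *)
Fact smulA : associative smul.
Proof.
move=> f g h; apply: funext => n.
have poly_coef (p q : {poly int}) i : smul (fun n => p`_n) (fun n => q`_n) i = (p * q)`_i.
  by rewrite coefM.
have trE k i : (i <= n)%N -> k i = (trunc n.+1 k)`_i.
  by move=> le_in; rewrite coef_poly ltnS le_in.
rewrite (@smul_coef_eq f (fun i => (trunc n.+1 f)`_i) (smul g h)
  (fun i => (trunc n.+1 g * trunc n.+1 h)`_i)); last 2 first.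
- exact: trE.
- by move=> i le_in; rewrite (@smul_trunc n.+1).
rewrite (@smul_coef_eq (smul f g) (fun i => (trunc n.+1 f * trunc n.+1 g)`_i) h
  (fun i => (trunc n.+1 h)`_i)); last 2 first.
- by move=> i le_in; rewrite (@smul_trunc n.+1).
- exact: trE.
by rewrite !poly_coef mulrA.
Qed.

Fact smul1 : left_id sone smul.
Proof.
move=> f; apply: funext => n; rewrite /smul big_ord_recl /= mul1r subn0.
by rewrite big1 ?addr0 // => i _; rewrite mul0r.
Qed.

Fact smulDl : left_distributive smul sadd.
Proof.
move=> f g h; apply: funext => n; rewrite /smul /sadd -big_split /=.
by apply: eq_bigr => i _; rewrite mulrDl.
Qed.

Fact sone_neq0 : sone != szero.
Proof. by apply/eqP => /(congr1 (@^~ 0%N)). Qed.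

HB.instance Definition _ :=
  GRing.Zmodule_isComNzRing.Build series smulA smulC smul1 smulDl sone_neq0.

Lemma smulE f g : smul f g = f * g. Proof. by []. Qed.
Lemma soneE : sone = 1. Proof. by []. Qed.

Lemma spowE f k : spow f k = f ^+ k.
Proof. by elim: k => [//|k IHk]; rewrite exprS -IHk. Qed.

Lemma coefsD (f g : series) n : (f + g) n = f n + g n. Proof. by []. Qed.
Lemma coefsN (f : series) n : (- f) n = - f n. Proof. by []. Qed.
Lemma coefsB (f g : series) n : (f - g) n = f n - g n. Proof. by []. Qed.
Lemma coefs1 n : (1 : series) n = (n == 0%N)%:R.
Proof. by rewrite -soneE /sone; case: eqP. Qed.
Lemma coefsM (f g : series) n : (f * g) n = \sum_(i < n.+1) f i * g (n - i)%N.
Proof. by []. Qed.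

Lemma coefsMn (f : series) k n : (f *+ k) n = f n *+ k.
Proof. by elim: k => [//|k IHk]; rewrite !mulrS coefsD IHk. Qed.

Lemma coefs_sum I (r : seq I) (P : pred I) (F : I -> series) n :
  (\sum_(i <- r | P i) F i) n = \sum_(i <- r | P i) F i n.
Proof. by elim/big_rec2: _ => [//|i y1 y2 _ <-]. Qed.

Lemma coefs_intr (k : int) f n : (k%:~R * f : series) n = k * f n.
Proof.
rewrite mulrzl; case: k => k.
  by rewrite -pmulrn coefsMn -mulr_natl natz.
by rewrite NegzE mulrNz coefsN -pmulrn coefsMn mulNr -mulr_natl natz.
Qed.

Lemma inv_list_nth f n i : (i <= n)%N -> nth 0 (inv_list f n) i = sinv f i.
Proof.
have size_inv m : size (inv_list f m) = m.+1.
  by elim: m => [//|m IHm] /=; rewrite size_rcons IHm.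
elim: n => [|n IHn]; first by rewrite leqn0 => /eqP ->.
rewrite leq_eqVlt => /predU1P [-> //|]; rewrite ltnS => le_in.
by rewrite /= nth_rcons size_inv ltnS le_in IHn.
Qed.

Lemma mulsV (f : series) : f 0%N = 1 -> f * sinv f = 1.
Proof.
move=> f0; apply: funext => -[|n]; rewrite coefsM.
  by rewrite big_ord1 f0 mul1r.
rewrite big_ord_recl f0 mul1r subn0.
have ->: sinv f n.+1 = - \sum_(k < n.+1) f k.+1 * nth 0 (inv_list f n) (n - k)%N.
  have size_inv m : size (inv_list f m) = m.+1.
    by elim: m => [//|m IHm] /=; rewrite size_rcons IHm.
  by rewrite /sinv /= nth_rcons size_inv ltnn eqxx.
rewrite coefs1 addrC; apply/eqP; rewrite subr_eq0; apply/eqP; apply: eq_bigr => i _.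
by rewrite inv_list_nth ?leq_subr.
Qed.

Lemma coefs0M (f g : series) : (f * g) 0%N = f 0%N * g 0%N.
Proof. by rewrite coefsM big_ord1. Qed.

Lemma coefs0X (f : series) k : (f ^+ k) 0%N = f 0%N ^+ k.
Proof. by elim: k => [//|k IHk]; rewrite !exprS coefs0M IHk. Qed.

(** Eta-quotient identities are proved in multiplied-out form; the factor cancelled has constant
    term 1, where [sinv] is a true inverse. *)
Lemma mulsI (f : series) : f 0%N = 1 -> injective ( *%R f).
Proof.
move=> f0 g h /(congr1 ( *%R (sinv f))).
by rewrite !mulrA ![sinv f * f]mulrC mulsV // !mul1r.
Qed.

Lemma muls_natI (k : nat) : (0 < k)%N -> injective ( *%R (k%:R : series)).
Proof.
move=> k_gt0 f g fg; apply: funext => n; have := congr1 (@^~ n) fg.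
rewrite !mulr_natl !coefsMn => /eqP; rewrite -subr_eq0 -mulrnBl mulrn_eq0 subr_eq0.
by rewrite eqn0Ngt k_gt0 => /eqP.
Qed.

(** Congruence modulo q^n, which stands in for convergence when finite products pass to infinite
    ones. *)
Definition eqmod (n : nat) (f g : series) := forall i, (i < n)%N -> f i = g i.

Lemma eqmod_refl n f : eqmod n f f. Proof. by []. Qed.
Lemma eqmod_sym n f g : eqmod n f g -> eqmod n g f.
Proof. by move=> fg i /fg. Qed.
Lemma eqmod_trans n g f h : eqmod n f g -> eqmod n g h -> eqmod n f h.
Proof. by move=> fg gh i lt_in; rewrite fg ?gh. Qed.
Lemma eqmod_le m n f g : (m <= n)%N -> eqmod n f g -> eqmod m f g.
Proof. by move=> le_mn fg i lt_im; apply: fg; apply: leq_trans le_mn. Qed.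
Lemma eqmodD n f f' g g' : eqmod n f f' -> eqmod n g g' -> eqmod n (f + g) (f' + g').
Proof. by move=> ff gg i lt_in; rewrite !coefsD ff ?gg. Qed.
Lemma eqmodN n f f' : eqmod n f f' -> eqmod n (- f) (- f').
Proof. by move=> ff i lt_in; rewrite !coefsN ff. Qed.
Lemma eqmodM n f f' g g' : eqmod n f f' -> eqmod n g g' -> eqmod n (f * g) (f' * g').
Proof.
move=> ff gg i lt_in; apply: smul_coef_eq => j le_ji; [apply: ff|apply: gg];
  exact: leq_ltn_trans lt_in.
Qed.
Lemma eqmodX n (f f' : series) k : eqmod n f f' -> eqmod n (f ^+ k) (f' ^+ k).
Proof. by move=> ff; elim: k => [//|k IHk]; rewrite !exprS; apply: eqmodM. Qed.
Lemma eqmod_sum n I (r : seq I) (P : pred I) F G :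
  (forall i, P i -> eqmod n (F i) (G i)) ->
  eqmod n (\sum_(i <- r | P i) F i) (\sum_(i <- r | P i) G i).
Proof.
by move=> FG; elim/big_rec2: _ => [//|i y1 y2 /FG]; exact: eqmodD.
Qed.
Lemma eqmod_eq f g : (forall n, eqmod n f g) -> f = g.
Proof. by move=> fg; apply: funext => n; apply: (fg n.+1). Qed.

Lemma eqmod_mulI n (f g h : series) : f 0%N = 1 -> eqmod n (f * g) (f * h) -> eqmod n g h.
Proof.
move=> f0 /(eqmodM (@eqmod_refl n (sinv f))).
by rewrite !mulrA ![sinv f * f]mulrC mulsV // !mul1r.
Qed.

Definition q : series := fun n => (n == 1)%:R.

Lemma coefs_qM (f : series) n : (q * f) n = if n is m.+1 then f m else 0.
Proof.
case: n => [|n]; rewrite coefsM big_ord_recl /= mul0r add0r ?big_ord0 //.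
rewrite big_ord_recl /= mul1r big1 ?addr0 ?subSS ?subn0 // => i _.
by rewrite /q mul0r.
Qed.

Lemma coefs_qXM k (f : series) n : (q ^+ k * f) n = if (n < k)%N then 0 else f (n - k)%N.
Proof.
elim: k n => [|k IHk] n; first by rewrite mul1r subn0.
rewrite exprS -mulrA coefs_qM; case: n => [//|n]; rewrite IHk ltnS subSS.
by [].
Qed.

Lemma eqmod_qXM m k f g : eqmod m f g -> eqmod (k + m) (q ^+ k * f) (q ^+ k * g).
Proof.
move=> fg i lt_i; rewrite !coefs_qXM; case: ltnP => // le_ki; apply: fg; lia.
Qed.

Lemma eqmod_qX0 k n f : (n <= k)%N -> eqmod n (q ^+ k * f) 0.
Proof. by move=> le_nk i lt_in; rewrite coefs_qXM (leq_trans lt_in). Qed.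

(** * Dissection modulo 3 *)

Definition dil (f : series) : series := fun n => if (3 %| n)%N then f (n %/ 3)%N else 0.
Definition sect (r : nat) (f : series) : series := fun n => f (3 * n + r)%N.

Lemma dil_mul3 f n : dil f (3 * n)%N = f n.
Proof. by rewrite /dil dvdn_mulr // mulKn. Qed.

Lemma sum_mul3 (F : nat -> int) m r : (r < 3)%N ->
  (forall i, ~~ (3 %| i)%N -> F i = 0) ->
  \sum_(i < (3 * m + r).+1) F i = \sum_(i < m.+1) F (3 * i)%N.
Proof.
move=> r_lt3 F0; elim: m => [|m IHm].
  rewrite muln0 add0n big_ord1 big_ord_recl big1 ?addr0 // => i _.
  by rewrite F0 //= /bump /=; have := ltn_ord i; lia.
have ->: (3 * m.+1 + r = (3 * m + r).+3)%N by lia.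
rewrite 3!big_ord_recr [RHS]big_ord_recr /= IHm -!addrA; congr (_ + _).
case: r r_lt3 {IHm} => [|[|[|//]]] _.
- have [z1 z2] : F (3 * m + 0).+1 = 0 /\ F (3 * m + 0).+2 = 0 by split; apply: F0; lia.
  by rewrite z1 z2 !add0r; congr F; lia.
- have [z1 z2] : F (3 * m + 1).+1 = 0 /\ F (3 * m + 1).+3 = 0 by split; apply: F0; lia.
  by rewrite z1 z2 add0r addr0; congr F; lia.
have [z1 z2] : F (3 * m + 2).+2 = 0 /\ F (3 * m + 2).+3 = 0 by split; apply: F0; lia.
by rewrite z1 z2 !addr0; congr F; lia.
Qed.

(** Sections are linear over series in q^3: in degree 3n + r only the indices 3i of [dil f]
    contribute, and i <= n because r < 3. *)
Lemma sect_dilM r (f g : series) : (r < 3)%N -> sect r (dil f * g) = f * sect r g.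
Proof.
move=> r_lt3; apply: funext => n; rewrite /sect !coefsM.
rewrite (@sum_mul3 (fun i => dil f i * g (3 * n + r - i)%N)) //; last first.
  by move=> i /negPf ndi; rewrite /dil ndi mul0r.
apply: eq_bigr => i _; rewrite dil_mul3; congr (_ * g _).
by have := ltn_ord i; lia.
Qed.

Lemma sect_eq f g : (forall r, (r < 3)%N -> sect r f = sect r g) -> f = g.
Proof.
move=> fg; apply: funext => n.
have := congr1 (@^~ (n %/ 3)%N) (fg _ (ltn_pmod n (isT : 0 < 3)%N)).
by rewrite /sect [(3 * _)%N]mulnC -divn_eq.
Qed.

Lemma sect_dil r f : (r < 3)%N -> sect r (dil f) = if r == 0%N then f else 0.
Proof.
case: r => [_|r lt_r3]; apply: funext => n; rewrite /sect.
  by rewrite addn0 dil_mul3.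
by rewrite /dil ifF //=; apply/negbTE; lia.
Qed.

Fact dil_is_zmod_morphism : zmod_morphism dil.
Proof.
move=> f g; apply: funext => n; rewrite coefsB /dil.
by case: ifP => // _; rewrite subrr.
Qed.
HB.instance Definition _ := GRing.isZmodMorphism.Build series series dil
  dil_is_zmod_morphism.

Fact dil_is_monoid_morphism : monoid_morphism dil.
Proof.
split=> [|f g].
  apply: sect_eq => r lt_r3; rewrite sect_dil //; apply: funext => n.
  rewrite [RHS]/sect coefs1 addn_eq0 muln_eq0 /=.
  by case: r {lt_r3} => [|r] /=; rewrite ?andbT ?andbF ?coefs1.
apply: sect_eq => r lt_r3; rewrite sect_dilM // !sect_dil //.
by case: eqP => // _; rewrite mulr0.
Qed.
HB.instance Definition _ := GRing.isMonoidMorphism.Build series series dil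
  dil_is_monoid_morphism.

Fact sect_is_zmod_morphism r : zmod_morphism (sect r).
Proof. by []. Qed.
HB.instance Definition _ r := GRing.isZmodMorphism.Build series series (sect r)
  (@sect_is_zmod_morphism r).

Lemma sect0_q f : sect 0 (q * f) = q * sect 2 f.
Proof.
apply: funext => n; rewrite coefs_qM /sect coefs_qM.
by case: n => [//|n]; rewrite mulnS /= addn0 addnC.
Qed.

Lemma sectS_q r f : sect r.+1 (q * f) = sect r f.
Proof. by apply: funext => n; rewrite /sect addnS coefs_qM. Qed.

Lemma dil_sectE f : f = dil (sect 0 f) + q * dil (sect 1 f) + q ^+ 2 * dil (sect 2 f).
Proof.
apply: sect_eq => -[|[|[|//]]] _.
all: rewrite !raddfD /= expr2 -mulrA.
all: by rewrite ?sect0_q ?sectS_q ?sect0_q ?sectS_q !sect_dil //= ?mulr0 ?addr0 ?add0r.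
Qed.

Lemma dil_q : dil q = q ^+ 3.
Proof.
rewrite -[q ^+ 3]mulr1 -(rmorph1 dil); apply: sect_eq => -[|[|[|//]]] _.
all: rewrite !exprS expr0 mulr1 -!mulrA.
all: rewrite ?sectS_q ?sect0_q ?sectS_q ?sect0_q ?sectS_q ?sect0_q !sect_dil //= ?mulr0 //.
by rewrite mulr1.
Qed.

Lemma eqmod_dil n f g : eqmod n f g -> eqmod n (dil f) (dil g).
Proof.
move=> fg i lt_in; rewrite /dil; case: ifP => // _; apply: fg.
by apply: leq_ltn_trans lt_in; exact: leq_div.
Qed.

Lemma eqmod_sect r n f g : (r < 3)%N -> eqmod (3 * n) f g -> eqmod n (sect r f) (sect r g).
Proof. move=> lt_r3 fg i lt_in; apply: fg; lia. Qed.

(* The norm of f over the subring of series in q^3, with q^3 renamed q: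
   dil (trinorm f) is the product of f(q), f(w q), f(w^2 q), w a cube root of unity. *)
Definition trinorm (f : series) : series :=
  sect 0 f ^+ 3 + q * sect 1 f ^+ 3 + q ^+ 2 * sect 2 f ^+ 3
  - 3%:R * q * sect 0 f * sect 1 f * sect 2 f.

(** [trinorm f] is the determinant of multiplication by f in the basis 1, q, q^2. Here [sM] expands
    the sections of the product, and what remains is a polynomial identity in six sections and q. *)
Lemma trinormM f g : trinorm (f * g) = trinorm f * trinorm g.
Proof.
have sM r : (r < 3)%N -> sect r (f * g) =
    sect 0 f * sect r g + sect 1 f * sect r (q * g) + sect 2 f * sect r (q * (q * g)).
  move=> lt_r3; rewrite {1}(dil_sectE f) !mulrDl !raddfD /=.
  rewrite -!sect_dilM //; congr (sect _ _ + sect _ _ + sect _ _); ring.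
rewrite /trinorm !sM // !(sect0_q, sectS_q).
move: (sect 0 f) (sect 1 f) (sect 2 f) (sect 0 g) (sect 1 g) (sect 2 g) => a b c d e h.
by move: q => x; ring.
Qed.

Lemma eqmod_trinorm n f g : eqmod (3 * n) f g -> eqmod n (trinorm f) (trinorm g).
Proof.
move=> fg; have fg_ r (lt_r3 : (r < 3)%N) := eqmod_sect lt_r3 fg.
rewrite /trinorm; repeat first [apply: eqmodD | apply: eqmodN | apply: eqmodM |
  apply: eqmodX | exact: fg_ | exact: eqmod_refl].
Qed.

(** * Eta products *)

Definition poch (k n : nat) : series := \prod_(i < n) (1 - q ^+ (k * i.+1)).

Lemma poch0 k : poch k 0 = 1. Proof. exact: big_ord0. Qed.
Lemma pochS k n : poch k n.+1 = poch k n * (1 - q ^+ (k * n.+1)).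
Proof. exact: big_ord_recr. Qed.

Definition series_of_poly (p : {poly int}) : series := fun n => p`_n.

Lemma series_of_poly1 : series_of_poly 1 = 1.
Proof. by apply: funext => n; rewrite /series_of_poly coef1 coefs1. Qed.

Lemma series_of_polyM : {morph series_of_poly : p r / p * r}.
Proof. by move=> p r; apply: funext => n; rewrite /series_of_poly coefM. Qed.

Lemma series_of_polyX m : series_of_poly 'X^m = q ^+ m.
Proof.
apply: funext => n; rewrite -[q ^+ m]mulr1 coefs_qXM coefs1 /series_of_poly coefXn.
by case: ltngtP => //; rewrite subn_eq0; lia.
Qed.

Lemma series_of_polyB p r : series_of_poly (p - r) = series_of_poly p - series_of_poly r.
Proof. by apply: funext => n; rewrite /series_of_poly coefB. Qed.

Lemma Eq_coef k n : Eq k n = poch k n n.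
Proof.
rewrite /Eq big_add1 /= big_mkord -[LHS]/(series_of_poly _ n); congr (_ n).
rewrite (big_morph _ series_of_polyM series_of_poly1); apply: eq_bigr => i _.
by rewrite series_of_polyB series_of_poly1 series_of_polyX.
Qed.

(** Each further factor is 1 modulo q^(n+1), its exponent being k times an index above n. *)
Lemma poch_stable k n m : (0 < k)%N -> (n <= m)%N -> eqmod n.+1 (poch k m) (poch k n).
Proof.
move=> k_gt0; elim: m => [|m IHm]; first by rewrite leqn0 => /eqP ->.
rewrite leq_eqVlt => /predU1P [-> //|]; rewrite ltnS => le_nm.
apply: eqmod_trans (IHm le_nm); rewrite pochS mulrBr mulr1 -[X in eqmod _ _ X]subr0.
apply: eqmodD => //; apply: eqmodN; rewrite mulrC; apply: eqmod_qX0.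
by apply: leq_trans (leq_pmull _ k_gt0).
Qed.

Lemma eqmod_Eq k n : (0 < k)%N -> eqmod n.+1 (Eq k) (poch k n).
Proof.
by move=> k_gt0 i lt_in; rewrite Eq_coef; apply/esym/poch_stable; rewrite // -ltnS.
Qed.

Lemma eqmod_Eq_le k m n : (0 < k)%N -> (m <= n)%N -> eqmod m (Eq k) (poch k n).
Proof. by move=> k_gt0 le_mn; apply: eqmod_le (eqmod_Eq k_gt0); rewrite leqW. Qed.

Lemma Eq0 k : Eq k 0%N = 1.
Proof. by rewrite Eq_coef poch0. Qed.

Lemma dil_poch k n : dil (poch k n) = poch (3 * k) n.
Proof.
rewrite rmorph_prod; apply: eq_bigr => i _.
by rewrite rmorphB rmorph1 rmorphXn /= dil_q -exprM mulnA.
Qed.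

Lemma dil_Eq k : (0 < k)%N -> dil (Eq k) = Eq (3 * k).
Proof.
move=> k_gt0; apply: eqmod_eq => n; apply: (@eqmod_trans _ (poch (3 * k) n)).
  by rewrite -dil_poch; apply/eqmod_dil/eqmod_Eq_le.
by apply/eqmod_sym/eqmod_Eq_le; rewrite // muln_gt0.
Qed.

Lemma dil0 f : dil f 0%N = f 0%N.
Proof. by []. Qed.

Lemma trinorm_dil f : trinorm (dil f) = f ^+ 3.
Proof. by rewrite /trinorm !sect_dil //=; ring. Qed.

Lemma sect_qX m r s f : (r < 3)%N -> (s < 3)%N ->
  sect r (q ^+ (3 * m + s) * dil f) = if r == s then q ^+ m * f else 0.
Proof.
move=> lt_r3 lt_s3.
rewrite exprD exprM -dil_q mulrAC -rmorphXn -rmorphM /= sect_dilM //.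
rewrite -[q ^+ s]mulr1 -(rmorph1 dil).
case: r s lt_r3 lt_s3 => [|[|[|//]]] [|[|[|//]]] _ _ /=.
all: rewrite ?expr0 ?expr1 ?expr2 ?mul1r -?mulrA ?(sectS_q, sect0_q) ?(sectS_q, sect0_q).
all: by rewrite sect_dil //= ?mulr0 ?mulr1.
Qed.

(** The three conjugates of 1 - q^m multiply to 1 - q^(3m) when 3 does not divide m, and q^3 is
    renamed q. *)
Lemma trinorm_1subqX m : ~~ (3 %| m)%N -> trinorm (1 - q ^+ m) = 1 - q ^+ m.
Proof.
move=> ndvd3m; have := divn_eq m 3.
move: (m %/ 3)%N (m %% 3)%N (ltn_pmod m (isT : 0 < 3)%N) => l s lt_s3 m_eq.
have {ndvd3m} s_neq0 : s <> 0%N by move=> s0; rewrite m_eq s0 addn0 dvdn_mull in ndvd3m.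
rewrite {m}m_eq mulnC.
have sE r : (r < 3)%N -> sect r (1 - q ^+ (3 * l + s)) =
    (if r == 0%N then 1 else 0) - if r == s then q ^+ l else 0.
  move=> lt_r3; rewrite -[q ^+ (_ + _)]mulr1 -{1 2}(rmorph1 dil) raddfB /= sect_qX //.
  by rewrite sect_dil // mulr1.
rewrite /trinorm !sE // exprD [(3 * l)%N]mulnC exprM.
by case: s lt_s3 s_neq0 {sE} => [|[|[|//]]] _ // _ /=; ring.
Qed.

(** Factors whose index is prime to 3 are their own norm; the factor of index 3i is a dilation, so
    its norm is the cube of the factor of index i. Multiplying by [poch (3 * k) n] restores the
    missing multiples of 3. *)
Lemma trinorm_poch k n : ~~ (3 %| k)%N ->
  trinorm (poch k (3 * n)) * poch (3 * k) n = poch k n ^+ 3 * poch k (3 * n).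
Proof.
move=> ndvd3k; elim: n => [|n IHn].
  by rewrite muln0 !poch0 expr1n -(rmorph1 dil) trinorm_dil rmorph1 expr1n.
have ->: (3 * n.+1 = (3 * n).+3)%N by lia.
rewrite !pochS !trinormM.
have nd s : (0 < s < 3)%N -> ~~ (3 %| k * (3 * n + s))%N.
  move=> s_bd; rewrite Euclid_dvdM // (negPf ndvd3k) /=; lia.
have e1 : (3 * n).+1 = (3 * n + 1)%N by lia.
have e2 : (3 * n).+2 = (3 * n + 2)%N by lia.
rewrite [trinorm (1 - q ^+ (k * (3 * n).+1))]trinorm_1subqX; last by rewrite e1 nd.
rewrite [trinorm (1 - q ^+ (k * (3 * n).+2))]trinorm_1subqX; last by rewrite e2 nd.
have e3 : (k * (3 * n).+3 = 3 * (k * n.+1))%N by lia.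
have -> : trinorm (1 - q ^+ (k * (3 * n).+3)) = (1 - q ^+ (k * n.+1)) ^+ 3.
  by rewrite -trinorm_dil rmorphB rmorph1 rmorphXn /= dil_q -exprM e3.
rewrite [(3 * k * n.+1)%N](_ : _ = (k * (3 * n).+3)%N); last by lia.
have step (t a b c d p p1 p3 : series) : t * p3 = p ^+ 3 * p1 ->
    t * a * b * c ^+ 3 * (p3 * d) = (p * c) ^+ 3 * (p1 * a * b * d).
  by move=> tp; transitivity (t * p3 * (a * b * c ^+ 3 * d)); [|rewrite tp]; ring.
exact: step.
Qed.

Lemma trinorm_Eq k : ~~ (3 %| k)%N -> trinorm (Eq k) * Eq (3 * k) = Eq k ^+ 4.
Proof.
move=> ndvd3k; have k_gt0 : (0 < k)%N by case: k ndvd3k.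
(* Taking sections divides the precision by 3, hence [3 * n] factors. *)
apply: eqmod_eq => n; apply: (@eqmod_trans _ (trinorm (poch k (3 * n)) * poch (3 * k) n)).
  apply: eqmodM; last by apply: eqmod_Eq_le; rewrite // muln_gt0.
  exact/eqmod_trinorm/eqmod_Eq_le.
rewrite trinorm_poch // [Eq k ^+ 4]exprSr; apply/eqmod_sym/eqmodM; first exact/eqmodX/eqmod_Eq_le.
by apply: eqmod_Eq_le => //; rewrite leq_pmull.
Qed.

(** * The Jacobi triple product *)

(* jtc Q n j is the Gaussian binomial coefficient [2n, n + j] in base Q, which is
   symmetric in j; only j >= 0 is tabulated. *)
Fixpoint jtc (R : comNzRingType) (Q : R) (n j : nat) : R :=
  if n is n'.+1 then
    (1 + Q ^+ (2 * n').+1) * jtc Q n' j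
    + (if j is j'.+1 then Q ^+ (n' - j') * jtc Q n' j' else Q ^+ n'.+1 * jtc Q n' 1)
    + Q ^+ (n' + j).+1 * jtc Q n' j.+1
  else (j == 0%N)%:R.

Definition qpoch (R : comNzRingType) (Q : R) (n : nat) : R := \prod_(i < n) (1 - Q ^+ i.+1).

(* The terms of index n and -n of Ramanujan's theta series f(a, b) are
   thterm a b n and thterm b a n. *)
Definition thterm (R : comNzRingType) (a b : R) (n : nat) : R :=
  a ^+ 'C(n.+1, 2) * b ^+ 'C(n, 2).

Definition theta (R : comNzRingType) (a b : R) (n : nat) : R :=
  1 + \sum_(i < n) (thterm a b i.+1 + thterm b a i.+1).

Section FiniteTripleProduct.
Variables (R : comNzRingType).
Implicit Types a b Q : R.

Lemma jtc_gt Q n j : (n < j)%N -> jtc Q n j = 0.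
Proof.
elim: n j => [|n IHn] [|j] //= lt_nj.
by rewrite !IHn ?mulr0 ?addr0 //; lia.
Qed.

Lemma qpochS Q n : qpoch Q n.+1 = qpoch Q n * (1 - Q ^+ n.+1).
Proof. exact: big_ord_recr. Qed.

(** The factorial formula for the Gaussian binomial, free of division. [same], [left] and [right]
    bring the three neighbours in row n over the common product
    [qpoch Q (n.+1 - j) * qpoch Q (n.+1 + j)], and [comb] adds them. *)
Lemma jtc_qpoch Q n j : (j <= n)%N ->
  jtc Q n j * qpoch Q (n - j) * qpoch Q (n + j) = qpoch Q (2 * n).
Proof.
elim: n j => [|n IHn] j; first by case: j => //= _; rewrite /qpoch !big_ord0 !mulr1.
have same i : (i <= n.+1)%N -> jtc Q n i * qpoch Q (n.+1 - i) * qpoch Q (n.+1 + i) =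
    (1 - Q ^+ (n.+1 - i)) * (1 - Q ^+ (n.+1 + i)) * qpoch Q (2 * n).
  rewrite leq_eqVlt => /predU1P [->|].
    by rewrite jtc_gt // subnn expr0 subrr !mul0r.
  rewrite ltnS => le_in; rewrite -(IHn i) // subSn // addSn !qpochS; ring.
have left i : (i <= n)%N -> jtc Q n i * qpoch Q (n - i) * qpoch Q (n + i).+2 =
    (1 - Q ^+ (n + i).+1) * (1 - Q ^+ (n + i).+2) * qpoch Q (2 * n).
  by move=> le_in; rewrite -(IHn i) // !qpochS; ring.
have right i : (i <= n.+1)%N -> jtc Q n i.+1 * qpoch Q (n.+1 - i) * qpoch Q (n.+1 + i) =
    (1 - Q ^+ (n.+1 - i)) * (1 - Q ^+ (n - i)) * qpoch Q (2 * n).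
  case: (ltnP i n) => [lt_in _|le_ni _].
    rewrite -(IHn i.+1) // subSn 1?ltnW // -[in (n - i)%N]subnSK // addSnnS !qpochS.
    by rewrite subnSK //; ring.
  by rewrite jtc_gt // (eqP (_ : n - i == 0)%N) ?subn_eq0 // expr0 subrr mulr0 !mul0r.
have -> : (2 * n.+1 = (2 * n).+2)%N by lia.
have comb (x y z c d e P S X Y Z : R) : x * P * S = X -> y * P * S = Y -> z * P * S = Z ->
    (c * x + d * y + e * z) * P * S = c * X + d * Y + e * Z.
  by move=> <- <- <-; ring.
have last2 : qpoch Q (2 * n).+2 = (1 - Q ^+ (2 * n).+1) * (1 - Q ^+ (2 * n).+2) * qpoch Q (2 * n).
  by rewrite !qpochS; ring.
move=> le_jn; rewrite last2 /=; case: j le_jn => [_|j le_jn].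
  (* At j = 0 the left neighbour -1 equals the right neighbour 1 by symmetry. *)
  rewrite (comb _ _ _ _ _ _ _ _ _ _ _ (same 0%N isT) (right 0%N isT) (right 0%N isT)).
  rewrite !subn0 !addn0 (_ : 2 * n = n + n)%N; last by lia.
  by rewrite !exprS !exprD; ring.
have leftj := left j le_jn; rewrite -[(n - j)%N]subSS -!addnS -[(n + j.+2)%N]addSnnS in leftj.
rewrite (comb _ _ _ _ _ _ _ _ _ _ _ (same _ le_jn) leftj (right _ le_jn)).
(* Writing n = j + m removes truncated subtractions from the exponents before [ring]; m = 0 is
   separate because there n - (j+1) is cut off. *)
have [m nE] : exists m, n = (j + m)%N by exists (n - j)%N; rewrite subnKC.
rewrite nE; case: m {nE} => [|m].
  have [-> -> -> -> ->] : [/\ (j + 0 - j = 0)%N, ((j + 0).+1 - j.+1 = 0)%N,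
    ((j + 0).+1 + j.+1 = j + j + 2)%N, (2 * (j + 0) = j + j)%N &
    (j + 0 + j.+1 = j + j + 1)%N] by split; lia.
  by rewrite !exprS !exprD; ring.
have [-> -> -> -> ->] : [/\ (j + m.+1 - j = m.+1)%N, ((j + m.+1).+1 - j.+1 = m.+1)%N,
  ((j + m.+1).+1 + j.+1 = j + j + m + 3)%N, (2 * (j + m.+1) = j + j + m + m + 2)%N &
  (j + m.+1 + j.+1 = j + j + m + 2)%N] by split; lia.
rewrite (_ : j + m.+1 - j.+1 = m)%N; last by lia.
by rewrite !exprS !exprD; ring.
Qed.

Lemma thtermS a b n : thterm a b n.+1 = a * (a * b) ^+ n * thterm a b n.
Proof.
rewrite /thterm binS [in b ^+ _]binS !bin1 !exprD exprMn exprS; ring.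
Qed.

(** The half of positive indices. By [thtermS], multiplying by a Q^n raises the index of a theta
    term and by b Q^n lowers it; the extra [Q ^+ n.+1 * c 1%N] is the term lowered from index 1 to
    0. *)
Lemma sum_thterm_jtc a b n (Q := a * b) (c := jtc Q n)
    (A := \sum_(i < n) thterm a b i.+1 * c i.+1) :
  \sum_(i < n.+1) thterm a b i.+1 * jtc Q n.+1 i.+1 + Q ^+ n.+1 * c 1%N =
  (1 + Q ^+ (2 * n).+1 + b * Q ^+ n) * A + a * Q ^+ n * (c 0%N + A).
Proof.
have c0 i : (n < i)%N -> c i = 0 by exact: jtc_gt.
have AE : A = \sum_(i < n.+1) thterm a b i.+1 * c i.+1.
  by rewrite big_ord_recr /= c0 // mulr0 addr0.
have up : a * Q ^+ n * (c 0%N + A) = \sum_(i < n.+1) thterm a b i.+1 * (Q ^+ (n - i) * c i).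
  rewrite (_ : c 0%N + A = \sum_(i < n.+1) thterm a b i * c i); last first.
    by rewrite big_ord_recl /thterm /= !expr0 !mul1r.
  rewrite mulr_sumr; apply: eq_bigr => i _; rewrite thtermS -/Q.
  have -> : Q ^+ n = Q ^+ i * Q ^+ (n - i) by rewrite -exprD subnKC // leq_ord.
  by ring.
have down : b * Q ^+ n * A =
    Q ^+ n.+1 * c 1%N + \sum_(i < n.+1) thterm a b i.+1 * (Q ^+ (n + i.+1).+1 * c i.+2).
  rewrite [X in _ + X]big_ord_recr /= [c n.+2]c0 // !mulr0 addr0 AE big_ord_recl mulrDr /=.
  rewrite (_ : thterm a b 1 = a) ?exprS /Q; last by rewrite /thterm /= expr1 expr0 mulr1.
  congr (_ + _); first by ring.
  rewrite mulr_sumr; apply: eq_bigr => i _; rewrite /bump /= add1n [in LHS]thtermS -/Q.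
  by rewrite [in RHS]exprS exprD /Q; ring.
rewrite [RHS](_ : _ = (1 + Q ^+ (2 * n).+1) * A + a * Q ^+ n * (c 0%N + A)
  + b * Q ^+ n * A); last by ring.
rewrite up down AE mulr_sumr [X in _ = _ + X]addrC addrA; congr (_ + _).
by rewrite -!big_split /=; apply: eq_bigr => i _; rewrite -/c; ring.
Qed.

Lemma finite_triple_product a b n (Q := a * b) :
  jtc Q n 0 + \sum_(i < n) (thterm a b i.+1 + thterm b a i.+1) * jtc Q n i.+1 =
  \prod_(k < n) ((1 + a * Q ^+ k) * (1 + b * Q ^+ k)).
Proof.
elim: n => [|n IHn]; first by rewrite !big_ord0 addr0.
rewrite [RHS]big_ord_recr -IHn.
have split_ab m k : \sum_(i < m) (thterm a b i.+1 + thterm b a i.+1) * jtc Q k i.+1 =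
    \sum_(i < m) thterm a b i.+1 * jtc Q k i.+1 + \sum_(i < m) thterm b a i.+1 * jtc Q k i.+1.
  by rewrite -big_split; apply: eq_bigr => i _; rewrite mulrDl.
rewrite !split_ab -/(jtc Q n.+1).
set A := \sum_(i < n) thterm a b _ * _; set A' := \sum_(i < n.+1) thterm a b _ * _.
set B := \sum_(i < n) thterm b a _ * _; set B' := \sum_(i < n.+1) thterm b a _ * _.
have ab : A' + Q ^+ n.+1 * jtc Q n 1 =
    (1 + Q ^+ (2 * n).+1 + b * Q ^+ n) * A + a * Q ^+ n * (jtc Q n 0 + A).
  exact: sum_thterm_jtc.
have ba : B' + Q ^+ n.+1 * jtc Q n 1 =
    (1 + Q ^+ (2 * n).+1 + a * Q ^+ n) * B + b * Q ^+ n * (jtc Q n 0 + B).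
  by rewrite /B /B' /Q [a * b]mulrC; exact: sum_thterm_jtc.
rewrite /= addn0.
(* The two equal neighbour terms in [jtc Q n.+1 0] are shared out, one to each half. *)
transitivity ((1 + Q ^+ (2 * n).+1) * jtc Q n 0 + (A' + Q ^+ n.+1 * jtc Q n 1) +
   (B' + Q ^+ n.+1 * jtc Q n 1)); first by ring.
rewrite ab ba [Q ^+ (2 * n).+1](_ : _ = a * b * Q ^+ n * Q ^+ n); first by ring.
by rewrite exprS mul2n -addnn exprD /Q; ring.
Qed.

End FiniteTripleProduct.

(** All three products in [jtc_qpoch] have at least n - j factors, so each is F modulo q^(n-j+1);
    this gives [jtc Q n j * F * F] congruent to F. *)
Lemma eqmod_jtc (F Q : series) n j : F 0%N = 1 -> (forall m, eqmod m.+1 F (qpoch Q m)) ->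
  (j <= n)%N -> eqmod (n - j).+1 (F * jtc Q n j) 1.
Proof.
move=> F0 Fq le_jn; apply: (eqmod_mulI F0); rewrite mulr1.
have le_q m : (n - j <= m)%N -> eqmod (n - j).+1 F (qpoch Q m).
  by move=> le_m; apply: eqmod_le (Fq m).
apply: eqmod_sym; apply: eqmod_trans (le_q (2 * n)%N _) _; first by lia.
rewrite -(jtc_qpoch Q le_jn) [X in eqmod _ _ X](_ : _ = jtc Q n j * F * F); last by ring.
by do 2 (apply: eqmodM; last by apply/eqmod_sym/le_q; lia).
Qed.

(** The precision j - 1 lost in [eqmod_jtc] is regained from the factor q^C(j,2) of the j-th theta
    term. *)
Lemma bin2_ge j : (j <= 'C(j, 2).+1)%N.
Proof. by elim: j => [//|j IHj]; rewrite binS bin1; case: j IHj => //; lia. Qed.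

Lemma eqmod_thterm_jtc (F a b r : series) n j :
  F 0%N = 1 -> (forall m, eqmod m.+1 F (qpoch (a * b) m)) -> a * b = q * r -> (j <= n)%N ->
  eqmod n (F * (thterm a b j * jtc (a * b) n j)) (thterm a b j).
Proof.
move=> F0 Fq abq le_jn.
have -> : thterm a b j = q ^+ 'C(j, 2) * (r ^+ 'C(j, 2) * a ^+ j).
  rewrite mulrA -exprMn -abq exprMn /thterm binS bin1 exprD; ring.
rewrite [X in eqmod _ X](_ : _ =
  q ^+ 'C(j, 2) * (r ^+ 'C(j, 2) * a ^+ j * (F * jtc (a * b) n j))); last by ring.
apply: (@eqmod_le _ ('C(j, 2) + (n - j).+1)); first by have := bin2_ge j; lia.
apply: eqmod_qXM; rewrite -[X in eqmod _ _ X]mulr1; apply: eqmodM => //.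
exact: eqmod_jtc.
Qed.

Lemma triple_product (F a b r : series) n :
  F 0%N = 1 -> (forall m, eqmod m.+1 F (qpoch (a * b) m)) -> a * b = q * r ->
  eqmod n (F * \prod_(k < n) ((1 + a * (a * b) ^+ k) * (1 + b * (a * b) ^+ k)))
    (theta a b n).
Proof.
move=> F0 Fq abq; rewrite -finite_triple_product mulrDr; apply: eqmodD.
  by apply: eqmod_le (eqmod_jtc F0 Fq (leq0n n)); rewrite subn0.
rewrite mulr_sumr; apply: eqmod_sum => i _; rewrite mulrDl mulrDr.
apply: eqmodD; first exact: (eqmod_thterm_jtc F0 Fq abq).
by rewrite [a * b]mulrC in abq Fq *; exact: (eqmod_thterm_jtc F0 Fq abq).
Qed.

(** Recognises f = E(q^K) W / U as a theta series: [u] and [w] are finite counterparts of [U] and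
    [W], linked to the finite product by an exact identity. *)
Lemma theta_eta (a b U W f u w : series) K n :
  (0 < K)%N -> a * b = q ^+ K -> U 0%N = 1 ->
  \prod_(k < n) ((1 + a * q ^+ (K * k)) * (1 + b * q ^+ (K * k))) * u = w ->
  eqmod n u U -> eqmod n w W -> U * f = Eq K * W -> eqmod n f (theta a b n).
Proof.
move=> K_gt0 abK U0 prod_uw uU wW UfE; apply: (eqmod_mulI U0).
have Fq m : eqmod m.+1 (Eq K) (qpoch (a * b) m).
  rewrite abK /qpoch (eq_bigr (fun i : 'I_m => 1 - q ^+ (K * i.+1))) => [|i _].
    exact: eqmod_Eq.
  by rewrite exprM.
have abq : a * b = q * q ^+ K.-1 by rewrite -exprS prednK.
rewrite UfE; apply: (@eqmod_trans _ (Eq K * w)); first by apply/eqmod_sym/eqmodM.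
rewrite -prod_uw mulrA mulrC; apply: eqmodM => //.
rewrite (eq_bigr (fun k : 'I_n => (1 + a * (a * b) ^+ k) * (1 + b * (a * b) ^+ k))).
  exact: triple_product (Eq0 K) Fq abq.
by move=> k _; rewrite abK exprM.
Qed.

Lemma pochD k m s :
  poch k (m + s) = poch k m * \prod_(i < s) (1 - q ^+ (k * m) * q ^+ (k * i.+1)).
Proof.
elim: s => [|s IHs]; first by rewrite addn0 big_ord0 mulr1.
by rewrite addnS pochS IHs big_ord_recr /= mulrA -exprD -mulnDr addnS.
Qed.

(** Groups m factors into one block of exponent step K, so that products with different k advance
    together in an induction on n. *)
Lemma poch_mulS K k m n : (k * m = K)%N ->
  poch k (m * n.+1) = poch k (m * n) * \prod_(i < m) (1 - q ^+ (K * n) * q ^+ (k * i.+1)).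
Proof. by move=> <-; rewrite mulnS addnC pochD mulnA. Qed.

Lemma prod_step (P p u u' w w' : series) :
  P * u = w -> p * u' = w' -> P * p * (u * u') = w * w'.
Proof. by move=> <- <-; ring. Qed.

(* phi and psi are Ramanujan's phi(-q) and psi(q); omega = f(-q, -q^5), aser = f(q, q^2). *)
Definition phi : series := Eq 1 ^+ 2 * sinv (Eq 2).
Definition psi : series := Eq 2 ^+ 2 * sinv (Eq 1).
Definition omega : series := Eq 1 * Eq 6 ^+ 2 * sinv (Eq 2) * sinv (Eq 3).
Definition aser : series := Eq 2 * Eq 3 ^+ 2 * sinv (Eq 1) * sinv (Eq 6).

Ltac eqmod_eta := repeat first [apply: eqmodM | apply: eqmodX | exact: eqmod_refl |
  apply/eqmod_sym/eqmod_Eq_le; lia].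

Lemma mulEV k : Eq k * sinv (Eq k) = 1.
Proof. by rewrite mulsV // Eq0. Qed.

Lemma theta_phi n : eqmod n phi (theta (- q) (- q) n).
Proof.
apply: (@theta_eta _ _ (Eq 2 ^+ 2) (Eq 1 ^+ 2) _ (poch 2 n ^+ 2) (poch 1 (2 * n) ^+ 2) 2) => //.
- ring.
- by rewrite coefs0X Eq0 expr1n.
- elim: n => [|n IHn]; first by rewrite big_ord0 !poch0 expr1n mul1r.
  rewrite big_ord_recr /= pochS (@poch_mulS 2) // !exprMn; apply: prod_step => //=.
  rewrite !big_ord_recr big_ord0 /= (mulnS _ n) exprD; ring.
- eqmod_eta.
- eqmod_eta.
have E := mulEV 2; rewrite /phi [LHS](_ : _ = (Eq 2 * sinv (Eq 2)) * (Eq 2 * Eq 1 ^+ 2)).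
  by rewrite E mul1r.
ring.
Qed.

(** Inclusion-exclusion over multiples of 2 and 3 isolates the factors 1 - q^m with m = 1 or 5
    modulo 6. *)
Lemma theta_omega n : eqmod n omega (theta (- q) (- q ^+ 5) n).
Proof.
apply: (@theta_eta _ _ (Eq 2 * Eq 3) (Eq 1 * Eq 6) _ (poch 2 (3 * n) * poch 3 (2 * n))
  (poch 1 (6 * n) * poch 6 n) 6) => //.
- ring.
- by rewrite coefs0M !Eq0.
- elim: n => [|n IHn]; first by rewrite big_ord0 !muln0 !poch0 !mul1r.
  rewrite big_ord_recr /= !(@poch_mulS 6) // pochS.
  rewrite (mulrACA (poch 2 _)) (mulrACA (poch 1 _)); apply: prod_step => //=.
  rewrite !big_ord_recr !big_ord0 /= (mulnS _ n) exprD; ring.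
- eqmod_eta.
- eqmod_eta.
have E2 := mulEV 2; have E3 := mulEV 3; rewrite /omega.
rewrite [LHS](_ : _ = (Eq 2 * sinv (Eq 2)) * (Eq 3 * sinv (Eq 3)) * (Eq 1 * Eq 6 ^+ 2)).
  by rewrite E2 E3; ring.
ring.
Qed.

(** Uses 1 + q^m = (1 - q^(2m))/(1 - q^m) for the m prime to 3. *)
Lemma theta_aser n : eqmod n aser (theta q (q ^+ 2) n).
Proof.
apply: (@theta_eta _ _ (Eq 1 * Eq 6) (Eq 2 * Eq 3) _ (poch 1 (3 * n) * poch 6 n)
  (poch 2 (3 * n) * poch 3 n) 3) => //.
- by rewrite coefs0M !Eq0.
- elim: n => [|n IHn]; first by rewrite big_ord0 !muln0 !poch0 !mul1r.
  rewrite big_ord_recr /= (@poch_mulS 3) // (@poch_mulS 6) // !pochS.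
  rewrite (mulrACA (poch 2 _)) (mulrACA (poch 1 _)); apply: prod_step => //=.
  rewrite !big_ord_recr !big_ord0 /= !(mulnS _ n) (_ : 6 * n = 3 * n + 3 * n)%N; last by lia.
  rewrite !exprD; ring.
- eqmod_eta.
- eqmod_eta.
have E1 := mulEV 1; have E6 := mulEV 6; rewrite /aser.
rewrite [LHS](_ : _ = (Eq 1 * sinv (Eq 1)) * (Eq 6 * sinv (Eq 6)) * (Eq 2 * Eq 3 ^+ 2)).
  by rewrite E1 E6; ring.
ring.
Qed.

(** The factor 1 + q^0 of the product is the 2. The factors 1 + q^k range over k < n and over k <=
    n, hence the correction 1 + q^n, which is 1 modulo q^n. *)
Lemma theta_psi n : eqmod n (2%:R * psi) (theta q 1 n).
Proof.
apply: (@theta_eta _ _ (Eq 1 ^+ 2) (2%:R * Eq 2 ^+ 2) _ (poch 1 n ^+ 2 * (1 + q ^+ n))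
  (2%:R * poch 2 n ^+ 2) 1) => //.
- ring.
- by rewrite coefs0X Eq0 expr1n.
- elim: n => [|n IHn]; first by rewrite big_ord0 !poch0 !expr1n expr0; ring.
  rewrite big_ord_recr !pochS /=.
  rewrite [RHS](_ : _ = 2%:R * poch 2 n ^+ 2 * (1 - q ^+ (2 * n.+1)) ^+ 2); last by ring.
  rewrite -IHn !mul1n [(2 * n.+1)%N]mulnC exprM !exprS; ring.
- rewrite -[X in eqmod _ _ X]mulr1; apply: eqmodM; first by eqmod_eta.
  rewrite -[X in eqmod _ _ X]addr0; apply: eqmodD => //.
  by rewrite -[q ^+ n]mulr1; exact: eqmod_qX0.
- eqmod_eta.
have E1 := mulEV 1; rewrite /psi.
rewrite [LHS](_ : _ = (Eq 1 * sinv (Eq 1)) * (2%:R * Eq 1 * Eq 2 ^+ 2)).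
  by rewrite E1; ring.
ring.
Qed.

(** * The 3-dissections and the modular equation *)

Lemma bin2_double n : ('C(n.+1, 2) * 2 = n * n.+1)%N.
Proof. by elim: n => [//|n IHn]; rewrite binS bin1 mulnDl IHn; lia. Qed.

Lemma thetaS (R : comNzRingType) (a b : R) n :
  theta a b n.+1 = theta a b n + (thterm a b n.+1 + thterm b a n.+1).
Proof. by rewrite /theta big_ord_recr /= addrA. Qed.

Lemma theta0 (R : comNzRingType) (a b : R) : theta a b 0 = 1.
Proof. by rewrite /theta big_ord0 addr0. Qed.

(** The sum of p^(m^2) over |m| <= 3n+1, split by m modulo 3; m -> -m swaps the classes 1 and 2. The
    bound 3n+1 gives each class exactly 2n+1 terms. *)
Lemma theta_square_dissection (R : comNzRingType) (p : R) n :
  theta p p (3 * n).+1 =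
  theta (p ^+ 9) (p ^+ 9) n + 2%:R * p * theta (p ^+ 3) (p ^+ 15) n.
Proof.
have tE i j (a b : R) k : a = p ^+ i -> b = p ^+ j ->
    thterm a b k = p ^+ (i * 'C(k.+1, 2) + j * 'C(k, 2)).
  by move=> -> ->; rewrite /thterm exprD !exprM.
elim: n => [|n IHn].
  by rewrite thetaS !theta0 !(tE 1%N 1%N p p) // /=; ring.
rewrite (_ : 3 * n.+1 = (3 * n).+3)%N; last by lia.
rewrite 3!thetaS IHn 2!thetaS !(tE 1%N 1%N p p) // !(tE 9%N 9%N (p ^+ 9)) //.
rewrite !(tE 3%N 15%N (p ^+ 3)) // !(tE 15%N 3%N (p ^+ 15)) //.
have := bin2_double n; have := bin2_double n.+1.
have := bin2_double (3 * n).+1; have := bin2_double (3 * n).+2.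
have := bin2_double (3 * n).+3; have := bin2_double (3 * n).+4.
set c1 := 'C((3 * n).+2, 2); set c2 := 'C((3 * n).+3, 2).
set c3 := 'C((3 * n).+4, 2); set c4 := 'C((3 * n).+4.+1, 2).
set d1 := 'C(n.+1, 2); set d2 := 'C(n.+2, 2) => e4 e3 e2 e1 f2 f1.
have -> : (1 * c2 + 1 * c1 = (3 * d2 + 15 * d1).+1)%N by lia.
have -> : (1 * c3 + 1 * c2 = 9 * d2 + 9 * d1)%N by lia.
have -> : (1 * c4 + 1 * c3 = (15 * d2 + 3 * d1).+1)%N by lia.
by rewrite !exprS; ring.
Qed.

(** The sum of p^(m(m+1)/2) over |m| <= 3n+1, split by m modulo 3; m -> -1-m swaps the classes 0 and
    2, and m = 3k+1 gives 9k(k+1)/2 + 1. *)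
Lemma theta_triangle_dissection (R : comNzRingType) (p : R) n :
  theta p 1 (3 * n).+1 =
  2%:R * theta (p ^+ 3) (p ^+ 6) n + p * theta (p ^+ 9) 1 n.
Proof.
have tE i j (a b : R) k : a = p ^+ i -> b = p ^+ j ->
    thterm a b k = p ^+ (i * 'C(k.+1, 2) + j * 'C(k, 2)).
  by move=> -> ->; rewrite /thterm exprD !exprM.
elim: n => [|n IHn].
  by rewrite thetaS !theta0 !(tE 1%N 0%N p 1) // (tE 0%N 1%N 1 p) //=; ring.
rewrite (_ : 3 * n.+1 = (3 * n).+3)%N; last by lia.
rewrite 3!thetaS IHn 2!thetaS !(tE 1%N 0%N p 1) // !(tE 0%N 1%N 1 p) //.
rewrite !(tE 3%N 6%N (p ^+ 3)) // !(tE 6%N 3%N (p ^+ 6)) //.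
rewrite !(tE 9%N 0%N (p ^+ 9)) // !(tE 0%N 9%N 1 (p ^+ 9)) //.
have := bin2_double n; have := bin2_double n.+1.
have := bin2_double (3 * n).+1; have := bin2_double (3 * n).+2.
have := bin2_double (3 * n).+3; have := bin2_double (3 * n).+4.
set c1 := 'C((3 * n).+2, 2); set c2 := 'C((3 * n).+3, 2).
set c3 := 'C((3 * n).+4, 2); set c4 := 'C((3 * n).+4.+1, 2).
set d1 := 'C(n.+1, 2); set d2 := 'C(n.+2, 2) => e4 e3 e2 e1 f2 f1.
rewrite !mul0n !mul1n !addn0 !add0n.
have -> : (c2 = 3 * d2 + 6 * d1)%N by lia.
have -> : (c1 = (9 * d1).+1)%N by lia.
have -> : (c3 = 6 * d2 + 3 * d1)%N by lia.
have -> : (c4 = (9 * d2).+1)%N by lia.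
by rewrite !exprS; ring.
Qed.

Lemma dil_thterm a b n : dil (thterm a b n) = thterm (dil a) (dil b) n.
Proof. by rewrite /thterm rmorphM !rmorphXn. Qed.

Lemma dil_theta a b n : dil (theta a b n) = theta (dil a) (dil b) n.
Proof.
rewrite /theta rmorphD rmorph1 rmorph_sum; congr (_ + _); apply: eq_bigr => i _.
by rewrite rmorphD /= !dil_thterm.
Qed.

Lemma dil_qX k : dil (q ^+ k) = q ^+ (3 * k).
Proof. by rewrite rmorphXn /= dil_q exprM. Qed.

Lemma phi_dissection : phi = dil (dil phi) - 2%:R * q * dil omega.
Proof.
apply: eqmod_eq => n; apply: (@eqmod_trans _ (theta (- q) (- q) (3 * n).+1)).
  by apply: (@eqmod_le _ (3 * n).+1); [lia | exact: theta_phi].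
rewrite theta_square_dissection.
have -> : theta ((- q) ^+ 9) ((- q) ^+ 9) n = dil (dil (theta (- q) (- q) n)).
  have e : dil (dil (- q)) = (- q) ^+ 9.
    by rewrite !rmorphN /= dil_q dil_qX; ring.
  by rewrite !dil_theta e.
have -> : theta ((- q) ^+ 3) ((- q) ^+ 15) n = dil (theta (- q) (- q ^+ 5) n).
  by rewrite dil_theta !rmorphN /= dil_q dil_qX; congr (theta _ _ n); ring.
apply: eqmodD; first exact/eqmod_dil/eqmod_dil/eqmod_sym/theta_phi.
rewrite mulrN mulNr; apply: eqmodN; apply: eqmodM => //.
exact/eqmod_dil/eqmod_sym/theta_omega.
Qed.

Lemma psi_dissection : psi = dil aser + q * dil (dil psi).
Proof.
apply: (@muls_natI 2) => //; apply: eqmod_eq => n.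
apply: (@eqmod_trans _ (theta q 1 (3 * n).+1)).
  by apply: (@eqmod_le _ (3 * n).+1); [lia | exact: theta_psi].
rewrite theta_triangle_dissection.
have -> : theta (q ^+ 9) 1 n = dil (dil (theta q 1 n)).
  by rewrite !dil_theta !rmorph1 dil_q dil_qX.
have -> : theta (q ^+ 3) (q ^+ 6) n = dil (theta q (q ^+ 2) n).
  by rewrite dil_theta dil_q dil_qX.
rewrite mulrDr; apply: eqmodD.
  by apply: eqmodM => //; exact/eqmod_dil/eqmod_sym/theta_aser.
rewrite mulrCA; apply: eqmodM => //.
have -> : 2%:R * dil (dil psi) = dil (dil (2%:R * psi)) by rewrite !rmorphM !rmorph_nat.
exact/eqmod_dil/eqmod_dil/eqmod_sym/theta_psi.
Qed.

Lemma coefs0_sinv f : sinv f 0%N = 1.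
Proof. by []. Qed.

Lemma phi0 : phi 0%N = 1.
Proof. by rewrite /phi coefs0M coefs0X Eq0 coefs0_sinv expr1n. Qed.

Lemma phi_Eq2 : phi * Eq 2 = Eq 1 ^+ 2.
Proof. by rewrite /phi -mulrA [_ * Eq 2]mulrC mulEV mulr1. Qed.

Lemma psi_Eq1 : psi * Eq 1 = Eq 2 ^+ 2.
Proof. by rewrite /psi -mulrA [_ * Eq 1]mulrC mulEV mulr1. Qed.

Lemma dil_phi_Eq6 : dil phi * Eq 6 = Eq 3 ^+ 2.
Proof. by have := congr1 dil phi_Eq2; rewrite rmorphM rmorphXn /= !dil_Eq. Qed.

Lemma dil_psi_Eq3 : dil psi * Eq 3 = Eq 6 ^+ 2.
Proof. by have := congr1 dil psi_Eq1; rewrite rmorphM rmorphXn /= !dil_Eq. Qed.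

Lemma dil_phi0 : dil phi 0%N = 1.
Proof. by rewrite dil0 phi0. Qed.

(* The norm of phi is computed twice, from its eta quotient and from its 3-dissection. *)
Lemma phi_quartic : phi ^+ 4 = dil phi ^+ 4 - 8%:R * q * omega ^+ 3 * dil phi.
Proof.
have N1 : trinorm phi * dil phi = phi ^+ 4.
  have E1 := @trinorm_Eq 1 isT; have E2 := @trinorm_Eq 2 isT.
  rewrite /= in E1 E2.
  have Nphi : trinorm phi * trinorm (Eq 2) = trinorm (Eq 1) ^+ 2.
    by rewrite -trinormM phi_Eq2 !expr2 trinormM.
  have c0 : (Eq 2 ^+ 4 * Eq 6) 0%N = 1 by rewrite coefs0M coefs0X !Eq0 expr1n.
  apply: (mulsI c0).
  transitivity (trinorm phi * (trinorm (Eq 2) * Eq (3 * 2)) * (dil phi * Eq 6)).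
    by rewrite E2; ring.
  transitivity ((phi * Eq 2) ^+ 4 * Eq 6); last by ring.
  rewrite dil_phi_Eq6 phi_Eq2 -exprM -[(2 * 4)%N]/(4 * 2)%N exprM -E1.
  rewrite [LHS](_ : _ = trinorm phi * trinorm (Eq 2) * (Eq 6 * Eq 3 ^+ 2)); last by ring.
  by rewrite Nphi -[(3 * 1)%N]/3%N; ring.
rewrite -N1.
have e : 2%:R * q * dil omega = q * dil (2%:R * omega).
  by rewrite [dil (_ * _)]rmorphM /= rmorph_nat; ring.
have s0 : sect 0 phi = dil phi.
  by rewrite {1}phi_dissection e raddfB /= sect0_q !sect_dil //= mulr0 subr0.
have sS r : (r < 2)%N -> sect r.+1 phi = if r == 0%N then - (2%:R * omega) else 0.
  move=> lt_r2; rewrite {1}phi_dissection e raddfB /= sectS_q !sect_dil //; last by lia.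
  by rewrite sub0r; case: eqP => // _; rewrite oppr0.
by rewrite /trinorm s0 !sS //=; ring.
Qed.

Definition wser : series := omega * sinv (dil phi).
Definition user : series := 2%:R * q * dil wser.

Lemma wser_dil_phi : wser * dil phi = omega.
Proof. by rewrite /wser -mulrA [_ * dil phi]mulrC (mulsV dil_phi0) mulr1. Qed.

(** This is why one series w serves both dissections; it also restores the prefactor in
    [sect2_gserM]. *)
Lemma aser_wser : aser * wser = dil psi.
Proof.
apply: (mulsI dil_phi0); rewrite [LHS](_ : _ = aser * (wser * dil phi)); last by ring.
have c0 : (Eq 3 * Eq 6 * (Eq 1 * Eq 2)) 0%N = 1 by rewrite !coefs0M !Eq0.
rewrite wser_dil_phi; apply: (mulsI c0).
transitivity ((Eq 1 * sinv (Eq 1)) * (Eq 2 * sinv (Eq 2)) * (Eq 3 * sinv (Eq 3)) *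
  (Eq 6 * sinv (Eq 6)) * (Eq 1 * Eq 2 * Eq 3 ^+ 2 * Eq 6 ^+ 2)).
  by rewrite /aser /omega; ring.
transitivity ((dil phi * Eq 6) * (dil psi * Eq 3) * (Eq 1 * Eq 2)); last by ring.
by rewrite !mulEV dil_phi_Eq6 dil_psi_Eq3; ring.
Qed.

Lemma phi_user : phi = dil (dil phi) * (1 - user).
Proof. by rewrite {1}phi_dissection -wser_dil_phi /user [dil (wser * _)]rmorphM /=; ring. Qed.

Lemma psi_user : 2%:R * psi = dil aser * (2%:R + user).
Proof. by rewrite {1}psi_dissection -aser_wser /user [dil (aser * _)]rmorphM /=; ring. Qed.

Lemma Xs_phi : Xs * phi ^+ 4 = dil phi ^+ 4.
Proof.
rewrite /Xs !spowE !smulE.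
have c0 : (Eq 1 ^+ 8 * Eq 6 ^+ 4) 0%N = 1 by rewrite coefs0M !coefs0X !Eq0 !expr1n.
have c1 : (Eq 1 ^+ 8 * Eq 6 ^+ 4 * Eq 2 ^+ 4) 0%N = 1.
  by rewrite coefs0M c0 coefs0X Eq0 expr1n.
apply: (mulsI c1); have V := mulsV c0.
transitivity ((Eq 1 ^+ 8 * Eq 6 ^+ 4 * sinv (Eq 1 ^+ 8 * Eq 6 ^+ 4)) *
  (Eq 2 ^+ 4 * Eq 3 ^+ 8) * (phi * Eq 2) ^+ 4); first by ring.
transitivity (Eq 1 ^+ 8 * Eq 2 ^+ 4 * (dil phi * Eq 6) ^+ 4); last by ring.
by rewrite V phi_Eq2 dil_phi_Eq6; ring.
Qed.

Lemma Xs_wser : Xs * (1 - 8%:R * q * wser ^+ 3) = 1.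
Proof.
have c0 : (dil phi ^+ 4) 0%N = 1 by rewrite coefs0X dil_phi0 expr1n.
apply: (mulsI c0); rewrite mulr1 -{2}Xs_phi phi_quartic -wser_dil_phi; ring.
Qed.

Notation vser := (dil Xs).

Lemma vser_user : vser * (1 - user ^+ 3) = 1.
Proof.
have -> : user ^+ 3 = dil (8%:R * q * wser ^+ 3).
  rewrite ![dil (_ * _)]rmorphM /= rmorphXn /= [dil (_ * _)]rmorphM /= rmorph_nat dil_q /user.
  ring.
by rewrite -{1}(rmorph1 dil) -rmorphB -rmorphM Xs_wser rmorph1.
Qed.

(** The ratios of phi at q, q^3 and q^9 give X v (1-u)^4 = 1, and v (1 + u + u^2) is the inverse of
    1 - u. *)
Lemma Xs_user : Xs = vser ^+ 3 * (1 + user + user ^+ 2) ^+ 4.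
Proof.
have v_phi : vser * dil phi ^+ 4 = dil (dil phi) ^+ 4.
  have := congr1 dil Xs_phi; rewrite [dil (_ * _)]rmorphM /= [dil (phi ^+ 4)]rmorphXn /=.
  by rewrite [dil (dil phi ^+ 4)]rmorphXn.
have Xv : Xs * vser * (1 - user) ^+ 4 = 1.
  have c0 : (dil phi ^+ 4) 0%N = 1 by rewrite coefs0X dil_phi0 expr1n.
  apply: (mulsI c0); rewrite mulr1 -[RHS]Xs_phi {2}phi_user exprMn -v_phi; ring.
transitivity (Xs * (vser * (1 - user ^+ 3)) ^+ 4).
  by rewrite vser_user expr1n mulr1.
transitivity (Xs * vser * (1 - user) ^+ 4 * (vser ^+ 3 * (1 + user + user ^+ 2) ^+ 4)).
  by ring.
by rewrite Xv mul1r.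
Qed.

(* With p = 1 - u and s = 1 + u + u^2 = 3 - 3p + p^2 one has v = 1/(p s) and X = s/p^3;
   clearing denominators turns the cubic into the polynomial identity
   s^4 = 30 s^2 p^2 - 108 s p + 81 - 12 s p^5 + 9 p^4 + p^8. *)
Lemma modular_cubic (R : comNzRingType) (u v x : R) :
  v * (1 - u ^+ 3) = 1 -> x = v ^+ 3 * (1 + u + u ^+ 2) ^+ 4 ->
  x ^+ 3 = (30%:R * v - 108%:R * v ^+ 2 + 81%:R * v ^+ 3) * x ^+ 2
    + (9%:R * v ^+ 2 - 12%:R * v) * x + v.
Proof.
move=> vu xE; pose p := 1 - u; pose s := 1 + u + u ^+ 2.
have vps : v * p * s = 1 by rewrite -vu /p /s; ring.
have xp : x * p ^+ 3 = s.
  transitivity (s * (v * p * s) ^+ 3); first by rewrite xE -/s; ring.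
  by rewrite vps expr1n mulr1.
have key : s ^+ 4 = 30%:R * s ^+ 2 * p ^+ 2 - 108%:R * s * p + 81%:R
    - 12%:R * s * p ^+ 5 + 9%:R * p ^+ 4 + p ^+ 8 by rewrite /s /p; ring.
have unitp y z : p ^+ 9 * s * y = p ^+ 9 * s * z -> y = z.
  have one y' : v ^+ 9 * s ^+ 8 * (p ^+ 9 * s * y') = y'.
    transitivity ((v * p * s) ^+ 9 * y'); first by ring.
    by rewrite vps expr1n mul1r.
  by move=> /(congr1 ( *%R (v ^+ 9 * s ^+ 8))); rewrite !one.
apply: unitp.
transitivity (s * (x * p ^+ 3) ^+ 3); first by ring.
transitivity (30%:R * (v * p * s) * (x * p ^+ 3) ^+ 2 * p ^+ 2
  - 108%:R * (v * p * s) * (v * p) * (x * p ^+ 3) ^+ 2 * p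
  + 81%:R * (v * p * s) * (v * p) ^+ 2 * (x * p ^+ 3) ^+ 2
  - 12%:R * (v * p * s) * (x * p ^+ 3) * p ^+ 5
  + 9%:R * (v * p * s) * (v * p) * (x * p ^+ 3) * p ^+ 4
  + (v * p * s) * p ^+ 8); last by ring.
have vp3 : (v * p) ^+ 2 * s ^+ 2 = 1 by rewrite -exprMn vps expr1n.
rewrite xp vps -exprS key; transitivity (30%:R * s ^+ 2 * p ^+ 2 - 108%:R * (v * p * s) * s * p
  + 81%:R * ((v * p) ^+ 2 * s ^+ 2) - 12%:R * s * p ^+ 5 + 9%:R * (v * p * s) * p ^+ 4 + p ^+ 8).
  by rewrite vp3 vps; ring.
ring.
Qed.

(** Coordinates along 1, u, u^2; since u is q times a series in q^3, these occupy the exponent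
    classes 0, 1, 2 modulo 3. *)
Definition tripart (a b c : series) : series := dil a + dil b * user + dil c * user ^+ 2.

Lemma sect_tripart0 a b c : sect 0 (tripart a b c) = a.
Proof.
rewrite /tripart !raddfD /= sect_dil //= !sect_dilM //.
have -> : user = q * dil (2%:R * wser).
  by rewrite /user [dil (_ * _)]rmorphM /= rmorph_nat; ring.
rewrite exprMn expr2 -rmorphXn -[q * q * _]mulrA !sect0_q sectS_q !sect_dil //=.
by rewrite !mulr0 !addr0.
Qed.

Lemma sect_tripart2 a b c : sect 2 (tripart a b c) = 4%:R * wser ^+ 2 * c.
Proof.
rewrite /tripart !raddfD /= sect_dil //= !sect_dilM //.
have -> : user = q * dil (2%:R * wser).
  by rewrite /user [dil (_ * _)]rmorphM /= rmorph_nat; ring.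
by rewrite exprMn expr2 -rmorphXn -[q * q * _]mulrA !sectS_q !sect_dil //=; ring.
Qed.

Section ModularCoefficients.
Variables (R : comNzRingType) (x : R).

(** X has coordinates [xal v], [v * xbe v], [v * xga v]; [rc2] and [rc1] are the coefficients of x^2
    and x in the cubic. A general ring allows evaluation at X as well as at v = X(q^3). *)
Definition xal : R := 10%:R * x - 36%:R * x ^+ 2 + 27%:R * x ^+ 3.
Definition xbe : R := 4%:R - 27%:R * x + 27%:R * x ^+ 2.
Definition xga : R := 1 - 18%:R * x + 27%:R * x ^+ 2.
Definition rc2 : R := 30%:R * x - 108%:R * x ^+ 2 + 81%:R * x ^+ 3.
Definition rc1 : R := 9%:R * x ^+ 2 - 12%:R * x.

End ModularCoefficients.

Section ModularCoefficientsMorphism.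
Variables (R S : comNzRingType) (f : {rmorphism R -> S}) (x : R).

Let morphE := (rmorphM f, rmorphB f, rmorphD f, rmorphXn f, rmorph1 f, rmorph_nat f).

Lemma rmorph_xal : f (xal x) = xal (f x). Proof. by rewrite /xal !morphE. Qed.
Lemma rmorph_xbe : f (xbe x) = xbe (f x). Proof. by rewrite /xbe !morphE. Qed.
Lemma rmorph_xga : f (xga x) = xga (f x). Proof. by rewrite /xga !morphE. Qed.
Lemma rmorph_rc2 : f (rc2 x) = rc2 (f x). Proof. by rewrite /rc2 !morphE. Qed.
Lemma rmorph_rc1 : f (rc1 x) = rc1 (f x). Proof. by rewrite /rc1 !morphE. Qed.

End ModularCoefficientsMorphism.

Lemma vser_user3 : vser * user ^+ 3 = vser - 1.
Proof. by rewrite -[X in _ = _ - X]vser_user; ring. Qed.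

Lemma tripart_Xs : Xs = tripart (xal Xs) (Xs * xbe Xs) (Xs * xga Xs).
Proof.
have vu := vser_user3; rewrite /tripart ![dil (Xs * _)]rmorphM /=.
rewrite rmorph_xal rmorph_xbe rmorph_xga [LHS]Xs_user /xal /xbe /xga /=.
move: vser user vu => v u vu.
(* The coefficients 1, 4, 10, 16, 19, 16, 10, 4, 1 of (1 + u + u^2)^4, sorted by exponent modulo
   3. *)
transitivity (v ^+ 3 + 16%:R * v ^+ 2 * (v * u ^+ 3) + 10%:R * v * (v * u ^+ 3) ^+ 2 +
  (4%:R * v ^+ 3 + 19%:R * v ^+ 2 * (v * u ^+ 3) + 4%:R * v * (v * u ^+ 3) ^+ 2) * u +
  (10%:R * v ^+ 3 + 16%:R * v ^+ 2 * (v * u ^+ 3) + v * (v * u ^+ 3) ^+ 2) * u ^+ 2).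
  by ring.
by rewrite vu; ring.
Qed.

(** The second factor carries v in its coordinates along u and u^2, so every u^3 produced comes with
    a v to absorb it. *)
Lemma tripartM_mod a b c x y z v : dil v * user ^+ 3 = dil v - 1 ->
  tripart a b c * tripart x (v * y) (v * z) = tripart
    (a * x + (b * z + c * y) * (v - 1))
    (a * (v * y) + b * x + c * z * (v - 1))
    (a * (v * z) + b * (v * y) + c * x).
Proof.
move=> vu; rewrite /tripart !(rmorphM dil, rmorphB dil, rmorphD dil, rmorph1 dil) /=.
move: (dil x) (dil y) (dil z) (dil a) (dil b) (dil c) (dil v) user vu => {}x {}y {}z f g h {}v u vu.
transitivity (f * x + (g * z + h * y) * (v * u ^+ 3)
  + (f * (v * y) + g * x + h * z * (v * u ^+ 3)) * u
  + (f * (v * z) + g * (v * y) + h * x) * u ^+ 2); first by ring.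
by rewrite vu; ring.
Qed.

Lemma tripartM_Xs a b c (x := xal Xs) (y := xbe Xs) (z := xga Xs) :
  tripart a b c * Xs = tripart
    (a * x + (b * z + c * y) * (Xs - 1))
    (a * (Xs * y) + b * x + c * z * (Xs - 1))
    (a * (Xs * z) + b * (Xs * y) + c * x).
Proof. by rewrite [X in _ * X]tripart_Xs (tripartM_mod _ _ _ _ _ _ vser_user3). Qed.

Definition reoffset_step (f0 f1 f2 : series) : series := rc2 Xs * f2 + rc1 Xs * f1 + Xs * f0.

(** The cubic has coefficients in Z[v], series in q^3, which pass through the section with v
    becoming X. *)
Lemma sect_rec r f i : (r < 3)%N -> sect r (f * Xs ^+ i.+3) =
  reoffset_step (sect r (f * Xs ^+ i)) (sect r (f * Xs ^+ i.+1)) (sect r (f * Xs ^+ i.+2)).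
Proof.
move=> lt_r3; rewrite /reoffset_step -!sect_dilM // -!raddfD /=; congr (sect r _).
rewrite rmorph_rc2 rmorph_rc1 /=.
rewrite -[i.+3]addn3 exprD (modular_cubic vser_user Xs_user) !exprS /rc2 /rc1.
by move: Xs => x; ring.
Qed.

Lemma gserE : gser * phi = psi ^+ 2.
Proof.
rewrite /gser !spowE smulE.
have c0 : (Eq 1 ^+ 4) 0%N = 1 by rewrite coefs0X Eq0 expr1n.
have c1 : (Eq 1 ^+ 4 * Eq 2) 0%N = 1 by rewrite coefs0M c0 Eq0.
apply: (mulsI c1); transitivity (Eq 2 ^+ 5 * (Eq 1 ^+ 4 * sinv (Eq 1 ^+ 4)) * (phi * Eq 2)).
  by ring.
transitivity (Eq 1 ^+ 2 * Eq 2 * (psi * Eq 1) ^+ 2); last by ring.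
by rewrite mulsV // phi_Eq2 psi_Eq1; ring.
Qed.

(** Expand (2+u)^2 v (1+u+u^2), where v (1+u+u^2) = 1/(1-u) comes from dividing by phi; the 4 is the
    square of the 2 in 2 psi. *)
Lemma gser_tripart : 4%:R * dil (dil phi) * gser =
  dil (aser ^+ 2) * tripart (9%:R * Xs - 5%:R) (9%:R * Xs - 1) (9%:R * Xs).
Proof.
have vu := vser_user3.
have gu : 4%:R * gser * (dil (dil phi) * (1 - user)) = (dil aser * (2%:R + user)) ^+ 2.
  by rewrite -phi_user -psi_user exprMn -gserE; ring.
transitivity (4%:R * gser * (dil (dil phi) * (1 - user)) * (vser * (1 + user + user ^+ 2))).
  transitivity (4%:R * dil (dil phi) * gser * (vser * (1 - user ^+ 3))); last by ring.
  by rewrite vser_user mulr1.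
rewrite gu rmorphXn /= exprMn -[LHS]mulrA; congr (_ * _); rewrite /tripart.
rewrite ![dil (_ - _)]rmorphB /= [dil (9%:R * _)]rmorphM /= !rmorph_nat rmorph1.
move: vser user vu => v u vu.
transitivity (4%:R * v + 8%:R * v * u + 9%:R * v * u ^+ 2 + 5%:R * (v * u ^+ 3) + v * u ^+ 3 * u).
  by ring.
by rewrite vu; ring.
Qed.

Lemma sect2_gserM f a b c :
  tripart (9%:R * Xs - 5%:R) (9%:R * Xs - 1) (9%:R * Xs) * f = tripart a b c ->
  sect 2 (gser * f) = dil gser * c.
Proof.
move=> fE; apply: (mulsI dil_phi0); apply: (@muls_natI 4) => //.
transitivity (sect 2 (dil (4%:R * dil phi) * (gser * f))).
  by rewrite sect_dilM // mulrA.
transitivity (sect 2 (dil (aser ^+ 2) * tripart a b c)).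
  congr (sect 2 _); rewrite -fE [RHS]mulrA -gser_tripart.
  by rewrite [dil (_ * _)]rmorphM /= rmorph_nat; ring.
rewrite sect_dilM // sect_tripart2.
transitivity (4%:R * (aser * wser) ^+ 2 * c); first by ring.
have := congr1 dil gserE; rewrite [dil (gser * phi)]rmorphM [dil (psi ^+ 2)]rmorphXn /= => ge.
by rewrite aser_wser -ge; ring.
Qed.


(** * Evaluation of the matrix rows *)

(** Every length N > K is allowed, so that shifted rows and rows of different degree can be summed
    over one common range. *)
Definition row_eval (h : series) (K : nat) (r : nat -> int) (z : series) : Prop :=
  [/\ r 0%N = 0, forall j, (K < j)%N -> r j = 0 &
      forall N, (K < N)%N -> h * \sum_(j < N) (r j)%:~R * Xs ^+ j = z].

Lemma row_eval_shift h K r z s N : row_eval h K r z -> (K + s < N)%N ->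
  h * \sum_(j < N) (r (j - s)%N)%:~R * Xs ^+ j = Xs ^+ s * z.
Proof.
move=> [r0 _ rE]; elim: s N => [|s IHs] N lt_N.
  rewrite mul1r -(rE N) ?addn0 //; last by rewrite addn0 in lt_N.
  by under eq_bigr do rewrite subn0.
case: N lt_N => [|N] lt_N; first by rewrite ltn0 in lt_N.
rewrite big_ord_recl sub0n r0 mul0r add0r exprS -mulrA -(IHs N); last by lia.
rewrite [RHS]mulrCA; congr (_ * _); rewrite mulr_sumr; apply: eq_bigr => j _.
by rewrite /bump /= subSS exprS mulrCA.
Qed.

Lemma row_eval_step h K x y z f0 f1 f2 :
  row_eval h K x f0 -> row_eval h (K + 4) y f1 -> row_eval h (K + 8) z f2 ->
  row_eval h (K + 12) (mstep x y z) (reoffset_step f0 f1 f2).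
Proof.
move=> Hx Hy Hz; have [[x0 xK _] [y0 yK _] [z0 zK _]] := And3 Hx Hy Hz.
(* Truncated subtraction sends out-of-range indices to 0, where the rows vanish, so the formula also
   covers j = 0. *)
have mE j : mstep x y z j = 30 * z (j - 1)%N - 108 * z (j - 2)%N + 81 * z (j - 3)%N
    - 12 * y (j - 1)%N + 9 * y (j - 2)%N + x (j - 1)%N.
  by case: j => [|//]; rewrite /mstep !sub0n x0 y0 z0; ring.
split=> // [j lt_j|N lt_N].
  by rewrite mE !zK ?yK ?xK ?mulr0 ?subr0 ?addr0 //; lia.
pose S r s := \sum_(j < N) (r (j - s)%N)%:~R * Xs ^+ j : series.
transitivity (h * (30%:R * S z 1%N - 108%:R * S z 2%N + 81%:R * S z 3%N
    - 12%:R * S y 1%N + 9%:R * S y 2%N + S x 1%N)).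
  congr (_ * _); rewrite /S !mulr_sumr -!sumrN -!big_split /=; apply: eq_bigr => j _.
  by rewrite mE !(rmorphD, rmorphB, rmorphM) /=; ring.
have [z1 z2 z3] : [/\ h * S z 1%N = Xs ^+ 1 * f2, h * S z 2%N = Xs ^+ 2 * f2 &
    h * S z 3%N = Xs ^+ 3 * f2].
  by split; apply: (row_eval_shift Hz); lia.
have [y1 y2] : h * S y 1%N = Xs ^+ 1 * f1 /\ h * S y 2%N = Xs ^+ 2 * f1.
  by split; apply: (row_eval_shift Hy); lia.
have x1 : h * S x 1%N = Xs ^+ 1 * f0 by apply: (row_eval_shift Hx); lia.
transitivity (30%:R * (h * S z 1%N) - 108%:R * (h * S z 2%N) + 81%:R * (h * S z 3%N)
    - 12%:R * (h * S y 1%N) + 9%:R * (h * S y 2%N) + h * S x 1%N); first by ring.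
by rewrite z1 z2 z3 y1 y2 x1 /reoffset_step /rc2 /rc1; ring.
Qed.

Definition horner_row (s : seq int) : series := foldr (fun c acc => Xs * (c%:~R + acc)) 0 s.

Lemma row_eval_of h K s : (size s <= K)%N -> row_eval h K (row_of s) (h * horner_row s).
Proof.
move=> le_sK; split=> // [[//|j] lt_j|N lt_N].
  by rewrite /= nth_default //; lia.
congr (_ * _); case: N lt_N => [//|N] lt_N; rewrite big_ord_recl mul0r add0r.
have {lt_N} : (size s <= N)%N by lia.
elim: s N {le_sK} => [|c s IHs] N le_sN.
  by rewrite big1 // => j _; rewrite /bump /= nth_nil mul0r.
case: N le_sN => [//|N] le_sN; rewrite big_ord_recl /= expr1 -(IHs N) //.
rewrite mulrDr mulrC mulr_sumr; congr (_ + _); apply: eq_bigr => j _.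
by rewrite /bump /= !add1n [Xs ^+ j.+2]exprS mulrCA.
Qed.

(** Three consecutive rows are carried along, as the recurrence of the matrix is that of [sect_rec].
    The support bound 4k for row k suits both matrices and matches the bound 4^alpha for d_alpha. *)
Lemma row_eval_mat h f r r1 r2 r3 : (r < 3)%N ->
  (size r1 <= 4)%N -> (size r2 <= 8)%N -> (size r3 <= 12)%N ->
  h * horner_row r1 = sect r (f * Xs ^+ 1) ->
  h * horner_row r2 = sect r (f * Xs ^+ 2) ->
  h * horner_row r3 = sect r (f * Xs ^+ 3) ->
  forall i, row_eval h (4 * i.+1) (mat r1 r2 r3 i.+1) (sect r (f * Xs ^+ i.+1)).
Proof.
move=> lt_r3 s1 s2 s3 e1 e2 e3 i.
suff : let: (x, y, z) := mtriple (row_of r1) (row_of r2) (row_of r3) i in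
  [/\ row_eval h (4 * i.+1) x (sect r (f * Xs ^+ i.+1)),
      row_eval h (4 * i.+2) y (sect r (f * Xs ^+ i.+2)) &
      row_eval h (4 * i.+3) z (sect r (f * Xs ^+ i.+3))].
  by rewrite /mat; case: mtriple => [[x y] z] [].
elim: i => [|i] /=; first by rewrite -e1 -e2 -e3; split; apply: row_eval_of.
case: mtriple => [[x y] z] [Hx Hy Hz]; split=> //; rewrite sect_rec //.
have -> : (4 * i.+4 = 4 * i.+1 + 12)%N by lia.
apply: row_eval_step => //.
  by have -> : (4 * i.+1 + 4 = 4 * i.+2)%N by lia.
by have -> : (4 * i.+1 + 8 = 4 * i.+3)%N by lia.
Qed.

(* The literals of the matrices are unary naturals; [ring] can only handle their
   binary expansions. *)
Fixpoint posr (R : comNzRingType) (p : BinNums.positive) : R :=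
  match p with
  | BinNums.xH => 1
  | BinNums.xO p => 2%:R * posr R p
  | BinNums.xI p => 1 + 2%:R * posr R p
  end.

Definition binr (R : comNzRingType) (n : BinNums.N) : R :=
  if n is BinNums.Npos p then posr R p else 0.

Lemma intr_pz (R : comNzRingType) n : (pz n)%:~R = binr R n.
Proof.
rewrite /pz -pmulrn; case: n => [//|p] /=; elim: p => [p IHp|p IHp|//] /=.
  by rewrite NatTrec.doubleE -muln2 mulnC -add1n natrD natrM IHp.
by rewrite NatTrec.doubleE -muln2 mulnC natrM IHp.
Qed.

Lemma intr_nz (R : comNzRingType) n : (nz n)%:~R = - binr R n.
Proof. by rewrite -intr_pz -mulrNz. Qed.

Lemma sect0_dil_gserM k a b c : Xs ^+ k = tripart a b c ->
  sect 0 (dil gser * Xs ^+ k) = gser * a.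
Proof. by move=> ->; rewrite sect_dilM // sect_tripart0. Qed.

Lemma Xs2_tripart : Xs ^+ 2 = tripart
  (xal Xs * xal Xs + (Xs * xbe Xs * xga Xs + Xs * xga Xs * xbe Xs) * (Xs - 1))
  (xal Xs * (Xs * xbe Xs) + Xs * xbe Xs * xal Xs + Xs * xga Xs * xga Xs * (Xs - 1))
  (xal Xs * (Xs * xga Xs) + Xs * xbe Xs * (Xs * xbe Xs) + Xs * xga Xs * xal Xs).
Proof. by rewrite expr2 {1}tripart_Xs tripartM_Xs. Qed.

Lemma amat_eval i :
  row_eval gser (4 * i.+1) (amat i.+1) (sect 0 (dil gser * Xs ^+ i.+1)).
Proof.
have e0 : sect 0 (dil gser * Xs ^+ 0) = gser by rewrite mulr1 sect_dil.
have e1 := sect0_dil_gserM (k := 1) tripart_Xs.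
have e2 := sect0_dil_gserM (k := 2) Xs2_tripart.
(* The cubic, started from X^0, yields row 3 without expanding X^3 in u. *)
have e3 := @sect_rec 0 (dil gser) 0 isT.
apply: row_eval_mat; try by [].
all: rewrite ?e3 ?e2 ?e1 ?e0 /horner_row [foldr]lock /foldr -lock.
all: move: pz nz (intr_pz series) (intr_nz series) => P M hP hM; rewrite !(hP, hM) /binr /posr.
all: rewrite {P M hP hM}/reoffset_step /rc1 /rc2 /xal /xbe /xga.
all: by move: Xs gser => x h; ring.
Qed.

(** Origin of d_1 = (9, 0, 0, ...): the u^2 coordinate of G is 9v. *)
Lemma sect2_gser : sect 2 gser = dil gser * (9%:R * Xs).
Proof.
by rewrite -[gser in LHS]mulr1; apply: sect2_gserM; rewrite mulr1.
Qed.

Lemma bmat_eval i :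
  row_eval (dil gser) (4 * i.+1) (bmat i.+1) (sect 2 (gser * Xs ^+ i.+1)).
Proof.
have e0 : sect 2 (gser * Xs ^+ 0) = dil gser * (9%:R * Xs) by rewrite mulr1 sect2_gser.
have e1 : sect 2 (gser * Xs ^+ 1) = _ := sect2_gserM (tripartM_Xs _ _ _).
have e2 : sect 2 (gser * Xs ^+ 2) = _ := sect2_gserM
  (etrans (mulrA _ _ _) (etrans (congr1 ( *%R^~ Xs) (tripartM_Xs _ _ _)) (tripartM_Xs _ _ _))).
have e3 := @sect_rec 2 gser 0 isT.
apply: row_eval_mat; try by [].
all: rewrite ?e3 ?e2 ?e1 ?e0 /horner_row [foldr]lock /foldr -lock.
all: move: pz nz (intr_pz series) (intr_nz series) => P M hP hM; rewrite !(hP, hM) /binr /posr.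
all: rewrite {P M hP hM}/reoffset_step /rc1 /rc2 /xal /xbe /xga.
all: by move: Xs (dil gser) => x h; ring.
Qed.

(** * The main induction *)

Lemma dXsumE al : dXsum al = \sum_(1 <= j < (4 ^ al).+1) (dseq al j)%:~R * Xs ^+ j.
Proof.
apply: funext => n; rewrite coefs_sum; apply: eq_bigr => j _.
by rewrite coefs_intr spowE.
Qed.

Lemma sect_intrM r (c : int) f : sect r (c%:~R * f) = c%:~R * sect r f.
Proof. by apply: funext => n; rewrite /sect !coefs_intr. Qed.

Lemma sect_dXsum r f h (m : nat -> nat -> int) al :
  (forall i, row_eval h (4 * i.+1) (m i.+1) (sect r (f * Xs ^+ i.+1))) ->
  (forall j, dseq al.+1 j = \sum_(1 <= k < (4 ^ al).+1) m k j * dseq al k) ->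
  sect r (f * dXsum al) = h * dXsum al.+1.
Proof.
move=> mE dE; rewrite !dXsumE mulr_sumr raddf_sum.
transitivity (\sum_(1 <= k < (4 ^ al).+1) \sum_(1 <= j < (4 ^ al.+1).+1)
    h * ((m k j * dseq al k)%:~R * Xs ^+ j)); last first.
  rewrite exchange_big mulr_sumr; apply: eq_bigr => j _.
  by rewrite -mulr_sumr dE rmorph_sum mulr_suml.
apply: eq_big_nat => -[//|k] /andP [_ lt_k] /=.
have [m0 _ mN] := mE k.
(* The summation range for d at the next index contains the support of every row used. *)
have lt_N : (4 * k.+1 < (4 ^ al.+1).+1)%N by rewrite ltnS expnS leq_mul.
rewrite mulrCA sect_intrM -(mN _ lt_N) big_ord_recl m0 mul0r add0r !big_add1 big_mkord.
rewrite !mulr_sumr; apply: eq_bigr => j _; rewrite /bump /= rmorphM /=; ring.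
Qed.

Lemma sect0_dXsum al : odd al -> sect 0 (dil gser * dXsum al) = gser * dXsum al.+1.
Proof.
move=> odd_al; apply: sect_dXsum amat_eval _ => j.
by case: al odd_al => //= al /negPf ->.
Qed.

Lemma sect2_dXsum al : ~~ odd al -> (0 < al)%N ->
  sect 2 (gser * dXsum al) = dil gser * dXsum al.+1.
Proof.
move=> even_al al_gt0; apply: sect_dXsum bmat_eval _ => j.
by case: al al_gt0 even_al => //= al _ ->.
Qed.

Lemma dil_gser : dil gser = smul (spow (Eq 6) 5) (sinv (spow (Eq 3) 4)).
Proof.
rewrite !spowE smulE.
have c0 k : (Eq k ^+ 4) 0%N = 1 by rewrite coefs0X Eq0 expr1n.
have gE : gser * Eq 1 ^+ 4 = Eq 2 ^+ 5.
  by rewrite /gser !spowE smulE -mulrA [sinv _ * _]mulrC mulsV ?mulr1.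
have := congr1 dil gE.
rewrite [dil (gser * _)]rmorphM /= [dil (Eq 1 ^+ _)]rmorphXn /= [dil (Eq 2 ^+ _)]rmorphXn /=.
rewrite !dil_Eq //.
move=> dgE; apply: (mulsI (c0 3)).
by rewrite mulrC dgE mulrCA mulsV // mulr1.
Qed.

(** With x = 9^b, 9x - 1 = 8x + (x - 1): the increment 2x is what the residue 2 adds at scale
    9^b. *)
Lemma offset_step b :
  ((3 ^ (2 * b.+1) - 1) %/ 4 = 2 * 3 ^ (2 * b) + (3 ^ (2 * b) - 1) %/ 4)%N.
Proof.
rewrite mulnS expnD; have : (0 < 3 ^ (2 * b))%N by rewrite expn_gt0.
by move: (3 ^ _)%N => x; lia.
Qed.

Theorem theorem2p6 (al : nat) : (1 <= al)%N ->
  (forall n : nat,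
     g (3 ^ (2 * al - 1) * n + (3 ^ (2 * al) - 1) %/ 4)%N =
     smul (smul (spow (Eq 6) 5) (sinv (spow (Eq 3) 4)))
          (dXsum (2 * al - 1)) n) /\
  (forall n : nat,
     g (3 ^ (2 * al) * n + (3 ^ (2 * al) - 1) %/ 4)%N =
     smul (smul (spow (Eq 2) 5) (sinv (spow (Eq 1) 4)))
          (dXsum (2 * al)) n).
Proof.
rewrite -dil_gser -/gser !smulE.
(* Residue 0 sends n to 3n, so the offset is unchanged. *)
have even_step b : (0 < b)%N ->
    (forall n, g (3 ^ (2 * b - 1) * n + (3 ^ (2 * b) - 1) %/ 4)%N =
      (dil gser * dXsum (2 * b - 1)) n) ->
    forall n, g (3 ^ (2 * b) * n + (3 ^ (2 * b) - 1) %/ 4)%N = (gser * dXsum (2 * b)) n.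
  move=> b_gt0 oddE n; have b2 : (2 * b = (2 * b - 1).+1)%N by lia.
  rewrite [dXsum _](congr1 dXsum b2) -sect0_dXsum; last by lia.
  by rewrite /sect addn0 -oddE [in X in (X * n)%N]b2 expnSr mulnA.
case: al => [//|al] _; elim: al => [|al [_ IH]].
  have odd1 n : g (3 ^ (2 * 1 - 1) * n + (3 ^ (2 * 1) - 1) %/ 4)%N =
      (dil gser * dXsum (2 * 1 - 1)) n.
    rewrite dXsumE big_add1 big_mkord.
    have -> : \sum_(j < 4) (dseq 1 j.+1)%:~R * Xs ^+ j.+1 = 9%:R * Xs.
      rewrite big_ord_recl big1 /= ?addr0 ?expr1 // => j _.
      by rewrite mul0r.
    by rewrite -sect2_gser.
  by split; last exact: even_step.
(* Residue 2 replaces n by 3n + 2 in the preceding even case. *)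
have oddS n : g (3 ^ (2 * al.+2 - 1) * n + (3 ^ (2 * al.+2) - 1) %/ 4)%N =
    (dil gser * dXsum (2 * al.+2 - 1)) n.
  have -> : (2 * al.+2 - 1 = (2 * al.+1).+1)%N by lia.
  rewrite -sect2_dXsum ?oddM // /sect -IH; congr g.
  by rewrite offset_step expnS; lia.
by split; last exact: even_step.
Qed.
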